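(* Let $\Gamma$ be a compact metric graph and let $G$ be a model for $\Gamma$ such that $G$ is a $k$-regular graph, where $k\geq 3$. Assume all edges of $G$ have the same length. Let $\phi \colon \Gamma' \rightarrow \Gamma$ be the universal covering map, and let $\mu_{\phi,\mathrm{can}}$ be the pushdown to $\Gamma$ of the canonical measure of $\Gamma'$. Then $\mu_{\phi, \mathrm{can}}(e)=1-2/k$ for all $e\in E(G)$.
   Context: Metric graphs. A metric graph is a connected metric space $\Gamma$ such that, for some fixed $\epsilon>0$, every point has a neighborhood isometric to a star-shaped set $S(n,r)=\{te^{2\pi i k/n} : 0\le t<r,\ k\in\mathbb{Z}\}\subset\mathbb{C}$ of finite valence $n$ and radius $r\geq\epsilon$, endowed with the path metric. $\Gamma$ need not be compact. A vertex set is a discrete subset $V\subset\Gamma$ containing all points of valence $\neq 2$ such that every connected component of $\Gamma\setminus V$ is isometric (in its path metric) to a bounded open interval. It determines a model $G$: the weighted graph with vertex set $V(G)=V$, edge set $E(G)$ the set of components of $\Gamma\setminus V$, and $\ell(e)>0$ the length of the edge $e$ (loops and multiple edges are allowed). A graph is $k$-regular if every vertex has valence $k$ (a loop contributes $2$ to the valence of its vertex). $\mathbb{E}(G)$ is the set of oriented edges; each edge has two orientations $e,\bar e\in\mathbb{E}(G)$; $e^-$ and $e^+$ are the initial and terminal vertices of $e$. An orientation $\mathcal{O}\subset\mathbb{E}(G)$ selects one orientation of each edge. Forms. $C^1(G,\mathbb{R})$ is the space of functions $\omega:\mathbb{E}(G)\to\mathbb{R}$ with $\omega(\bar e)=-\omega(e)$;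 put $\omega_e=\omega(e)/\ell(e)$, and let $de\in C^1(G,\mathbb{R})$ be defined by $(de)(e)=\ell(e)$ and $(de)(e')=0$ for $e'\in\mathcal{O}$, $e'\ne e$. The (partially defined) pairing is $\langle\omega,\omega'\rangle=\sum_{e\in\mathcal{O}}\omega_e\omega'_e\ell(e)$, and $C^1_{L^2}(G,\mathbb{R})=\{\omega : \langle\omega,\omega\rangle<\infty\}$ is a Hilbert space. A form is harmonic if for every $v\in V(G)$, $\sum_{e\in\mathcal{O},\,e^+=v}\omega_e-\sum_{e\in\mathcal{O},\,e^-=v}\omega_e=0$. The harmonic $L^2$ forms form a closed subspace $\mathcal{H}_{L^2}(\Gamma)$ of $C^1_{L^2}(G,\mathbb{R})$; when models are refined (edges subdivided, keeping the values $\omega_e$ on the pieces) this space does not change. Canonical measure and pushdown. The canonical measure $\mu^{\Gamma}_{\mathrm{can}}$ is the Borel measure on $\Gamma$ which on each edge of a model $G$ is a constant multiple of Lebesgue measure $dx$, with $\mu^\Gamma_{\mathrm{can}}(e)=(\pi(de))_e=\frac{1}{\ell(e)}\langle\pi(de),de\rangle$, where $\pi$ is the orthogonal projection onto $\mathcal{H}_{L^2}(\Gamma)$; it is independent of the model and orientation. For the universal cover $\phi:\Gamma'\to\Gamma$ (with the metric for which $\phi$ is isometric on sheets), the pushdown $\mu_{\phi,\mathrm{can}}$ is the measure on $\Gamma$ with constant density on each edge $e$ of $G$ and $\mu_{\phi,\mathrm{can}}(e)=\mu^{\Gamma'}_{\mathrm{can}}(e')$ for any lift $e'$ of $e$ to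 $\Gamma'$. *)

(* Defs.v *)
From HB Require Import structures.
From mathcomp Require Import all_boot all_order all_algebra.
From mathcomp Require Import all_classical all_reals all_analysis.

Set Implicit Arguments.
Unset Strict Implicit.
Unset Printing Implicit Defensive.

Import Order.TTheory GRing.Theory Num.Theory.
Import numFieldNormedType.Exports.

Local Open Scope classical_set_scope.
Local Open Scope ring_scope.

(* The base point only records nonemptiness: the library requires it in order
   to build the Borel sigma-algebra. *)
#[short(type="pmetricType")]
HB.structure Definition PointedMetric (R : numDomainType) :=
  {T of Pointed T & Metric R T}.

Section MetricGraph.
Context {R : realType} {T : pmetricType R}.

(* In polar coordinates (i, t) for the point t e^(2 pi i k / n), this is the
   path metric of the star {t e^(2 pi i k / n) : 0 <= t < r}. *)
Definition star_dist (n : nat) (i j : 'I_n) (s t : R) : R :=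
  if i == j then `|s - t| else s + t.

(* x has a neighbourhood isometric to the star of valence n and radius r, by an
   isometry sending the centre to x; sigma i is the i-th ray. The singleton
   [set x] only matters for n = 0, where the star is a point. *)
Definition star_neighborhood (x : T) (n : nat) (r : R) : Prop :=
  exists sigma : 'I_n -> R -> T,
    [/\ forall i, sigma i 0 = x,
        forall i j (s t : R), s \in `[0, r[ -> t \in `[0, r[ ->
          mdist (sigma i s) (sigma j t) = star_dist i j s t
      & nbhs x ([set x] `|` \bigcup_i (sigma i @` `[0, r[))].

Definition metric_graph : Prop :=
  connected [set: T] /\
  exists2 eps : R, 0 < eps &
    forall x, exists n r, eps <= r /\ star_neighborhood x n r.

Definition has_valence (x : T) (n : nat) : Prop :=
  exists2 r : R, 0 < r & star_neighborhood x n r.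

Definition path_length (g : R -> T) : \bar R :=
  ereal_sup [set (\sum_(0 <= n < size s)
      mdist (g (nth 1 (0 :: s) n)) (g (nth 1 (0 :: s) n.+1)))%:E
    | s in itv_partition 0 1].

Definition path_dist (A : set T) (x y : T) : \bar R :=
  ereal_inf [set path_length g | g in [set g : R -> T |
    [/\ {within `[0, 1], continuous g}, g 0 = x, g 1 = y
      & g @` `[0, 1] `<=` A]]].

(* g restricts to an isometry from the open interval (0, l) onto C, where C
   carries its path metric. *)
Definition unit_param (C : set T) (l : R) (g : R -> T) : Prop :=
  [/\ 0 < l, g @` `]0, l[ = C
    & forall s t : R, s \in `]0, l[ -> t \in `]0, l[ ->
        path_dist C (g s) (g t) = `|s - t|%:E].

Definition edges (V : set T) : set (set T) :=
  [set C | exists2 x, ~ V x & C = connected_component (~` V) x].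

Definition vertex_set (V : set T) : Prop :=
  [/\ V `<=` isolated V,
      forall x n, has_valence x n -> n <> 2%N -> V x
    & forall C, edges V C -> exists l g, unit_param C l g].

(* An oriented edge of the model with vertex set V is represented by its unit
   speed parametrization, extended by constants on both sides of [0, elen];
   each edge thus has exactly two oriented edges above it, even when it is a
   loop. *)
Record oriented_edge (V : set T) := OrientedEdge {
  elen : R;
  epar : R -> T;
  epar_edge : edges V (epar @` `]0, elen[);
  epar_unit : unit_param (epar @` `]0, elen[) elen epar;
  epar_continuous : continuous epar;
  epar_left : forall t, t <= 0 -> epar t = epar 0;
  epar_right : forall t, elen <= t -> epar t = epar elen }.

HB.instance Definition _ (V : set T) := gen_eqMixin (oriented_edge V).
HB.instance Definition _ (V : set T) := gen_choiceMixin (oriented_edge V).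

Section Model.
Context {V : set T}.
Implicit Types (e : oriented_edge V) (O : set (oriented_edge V)).
Implicit Types (w : oriented_edge V -> R).

Definition edge_set e : set T := epar e @` `]0, elen e[.
Definition eminus e : T := epar e 0.
Definition eplus e : T := epar e (elen e).

Definition rpar e : R -> T := fun t => epar e (elen e - t).

Lemma rpar_image e : rpar e @` `]0, elen e[ = epar e @` `]0, elen e[.
Proof.
have H t : (t \in `]0, elen e[) -> (elen e - t \in `]0, elen e[).
  by rewrite !in_itv/= => /andP[? ?]; rewrite subr_gt0 gtrBl; apply/andP.
apply/seteqP; split=> x [t /= /H tl <-]; first by exists (elen e - t).
by exists (elen e - t) => //; rewrite /rpar subKr.
Qed.

Lemma rpar_edge e : edges V (rpar e @` `]0, elen e[).
Proof. by rewrite rpar_image; exact: epar_edge. Qed.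

Lemma rpar_unit e : unit_param (rpar e @` `]0, elen e[) (elen e) (rpar e).
Proof.
have [l0 _ eiso] := epar_unit e; split=> // s t.
rewrite !in_itv/= => /andP[s0 sl] /andP[t0 tl].
rewrite rpar_image eiso ?in_itv/= ?subr_gt0 ?gtrBl ?sl ?s0 ?tl ?t0//.
by rewrite opprB addrC addrA subrK distrC.
Qed.

Lemma rpar_continuous e : continuous (rpar e).
Proof.
move=> t; apply: (@continuous_comp _ _ _ (fun t => elen e - t) (epar e)).
  by apply: continuousB; [exact: cst_continuous|exact: id].
exact: epar_continuous.
Qed.

Lemma rpar_left e t : t <= 0 -> rpar e t = rpar e 0.
Proof.
by move=> t0; rewrite /rpar subr0; apply: epar_right; rewrite lerDl oppr_ge0.
Qed.

Lemma rpar_right e t : elen e <= t -> rpar e t = rpar e (elen e).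
Proof.
by move=> tl; rewrite /rpar subrr; apply: epar_left; rewrite subr_le0.
Qed.

Definition ebar e : oriented_edge V :=
  OrientedEdge (rpar_edge e) (rpar_unit e) (@rpar_continuous e)
    (@rpar_left e) (@rpar_right e).

(* Counting oriented edges makes a loop contribute 2. *)
Definition vertex_valence (v : T) (k : nat) : Prop :=
  ([set e : oriented_edge V | eminus e = v] #= `I_k)%card.

Definition orientation O : Prop := forall e, O (ebar e) <-> ~ O e.

Definition is_form w : Prop := forall e, w (ebar e) = - w e.

Definition coef w e : R := w e / elen e.

Definition dform e : oriented_edge V -> R := fun e' =>
  if e' == e then elen e else if e' == ebar e then - elen e else 0.

(* The signed series is split into its positive and negative parts, which both
   converge when w and w' are square-integrable. *)
Definition pairing O w w' : \bar R :=
  let f := fun e => (coef w e * coef w' e * elen e)%:E in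
  (\esum_(e in O) (f^\+ e) - \esum_(e in O) (f^\- e))%E.

Definition L2_form O w : Prop := is_form w /\ (pairing O w w < +oo)%E.

Definition harmonic_form O w : Prop := forall v, V v ->
  \sum_(e \in O `&` [set e | eplus e = v]) coef w e
  - \sum_(e \in O `&` [set e | eminus e = v]) coef w e = 0.

Definition harmonic_L2 O : set (oriented_edge V -> R) :=
  [set w | L2_form O w /\ harmonic_form O w].

Definition harmonic_proj O w : oriented_edge V -> R :=
  xget (fun=> 0) [set h | harmonic_L2 O h /\
    forall z, harmonic_L2 O z -> pairing O (fun e => w e - h e) z = 0%E].

End Model.

Definition regular_model (V : set T) (k : nat) : Prop :=
  forall v, V v -> @vertex_valence V v k.

Definition equal_lengths (V : set T) : Prop :=
  forall e e' : oriented_edge V, elen e = elen e'.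

Definition borel := g_sigma_algebraType (@open T).

Definition constant_density (V : set T) (e : oriented_edge V)
    (mu : {measure set borel -> \bar R}) : Prop :=
  exists c : R, forall A : set borel, measurable A -> A `<=` edge_set e ->
    let B := `]0, elen e[ `&` epar e @^-1` A in
    mu A = (c%:E * lebesgue_measure B)%E.

(* The description holds in every model and for every orientation, the measure
   being independent of both; vertices carry no mass. *)
Definition canonical_measure (mu : {measure set borel -> \bar R}) : Prop :=
  forall (V : set T) (O : set (oriented_edge V)),
    vertex_set V -> orientation O ->
    mu V = 0%E /\
    forall e, O e -> constant_density e mu /\
      mu (edge_set e) = (coef (harmonic_proj O (dform e)) e)%:E.

Definition simply_connected : Prop :=
  (forall x y : T, exists g : R -> T,
     [/\ {within `[0, 1], continuous g}, g 0 = x & g 1 = y]) /\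
  (forall g : R -> T, {within `[0, 1], continuous g} -> g 0 = g 1 ->
     exists H : R * R -> T,
       [/\ {within `[0, 1] `*` `[0, 1], continuous H},
           forall t, t \in `[0, 1] -> H (0, t) = g t,
           forall t, t \in `[0, 1] -> H (1, t) = g 0
         & forall s, s \in `[0, 1] -> H (s, 0) = g 0 /\ H (s, 1) = g 0]).

End MetricGraph.
Arguments metric_graph {R} T.
Arguments simply_connected {R} T.
Arguments borel {R} T.

Section Covering.
Context {R : realType} {T' T : pmetricType R}.
Implicit Types (phi : T' -> T).

(* S is a family of sheets of phi above the open set U. *)
Definition sheets phi (U : set T) (S : set (set T')) : Prop :=
  [/\ open U, \bigcup_(W in S) W = phi @^-1` U, trivIset S id
    & forall W, S W -> [/\ open W, set_bij W U phi
        & forall B, open B -> B `<=` W -> open (phi @` B)]].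

Definition covering_map phi : Prop :=
  [/\ continuous phi, set_surj setT setT phi
    & forall x, exists U S, U x /\ sheets phi U S].

Definition universal_covering phi : Prop :=
  covering_map phi /\ simply_connected T'.

Definition isometric_on_sheets phi : Prop :=
  forall x, exists U S, [/\ U x, sheets phi U S
    & forall W, S W -> {in W &, forall y z, mdist (phi y) (phi z) = mdist y z}].

(* nu is the pushdown of mu along phi; the lifts of an edge C of the model
   with vertex set V are the edges above C of the model with vertex set
   phi^-1(V). *)
Definition pushdown (V : set T) phi (mu : {measure set (borel T') -> \bar R})
    (nu : {measure set (borel T) -> \bar R}) : Prop :=
  [/\ nu V = 0%E,
      forall e : oriented_edge V, constant_density e nu
    & forall C C', edges V C -> edges (phi @^-1` V) C' -> phi @` C' = C ->
        nu C = mu C'].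

End Covering.

(* Main.v *)
Require Import Defs.
From mathcomp Require Import all_boot all_order all_algebra.
From mathcomp Require Import all_classical all_reals all_analysis.
From mathcomp Require Import ring lra.

(* Let q = k - 1 and let e be an edge of the universal cover, which is a
   k-regular tree with edges of equal length l.  The form with coefficient
   q^-n on the edges at distance n from e, oriented along e (away from e on the
   side of e^+, towards e on the side of e^-), is harmonic and square-integrable.
   A harmonic form z has total flow z_e through the edges at distance n on
   either side, so the pairing of the radial form with z is
   l z_e (1 + 2 sum_(n >= 1) q^-n) = l z_e (q + 1) / (q - 1), whereas
   <de, z> = l z_e: the projection of de is (q - 1) / (q + 1) = 1 - 2 / k times
   the radial form.  The tree property amounts to every edge f being a bridge:
   a path from f^+ to f^- avoiding f would close up, together with f, to a loop
   winding once around the circle obtained by collapsing the complement of f,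
   and such a loop is not null-homotopic. *)

Set Implicit Arguments.
Unset Strict Implicit.
Unset Printing Implicit Defensive.

Import Order.TTheory GRing.Theory Num.Theory.
Import numFieldNormedType.Exports.

Local Open Scope classical_set_scope.
Local Open Scope ring_scope.

(** * Levels of a tree around an edge *)

(** Two features of the definitions shape the proof. First, [unit_param] makes an edge isometric to
    an interval only for its path metric, while stars and sheets are controlled by [mdist], which
    may be smaller. The comparison is local: near an interior point of an edge the star has valence
    2, and this forces the parametrization to be an isometry for [mdist]. The property passes to
    lifts, and path distances in the cover are recovered from it. Compactness of the base gives one
    radius at which every point of the cover has a section, so edges lift in finitely many steps,
    and the preimage of [V] is the model in which the canonical measure is evaluated. Second, the
    pairing is a series over an arbitrary orientation, split by signs. Summability lets it be
    regrouped by levels, and on a level the radial coefficient is constant, so only the flow of the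
    other form matters. The circle of the bridge argument is not constructed: a height modulo 1,
    with its reduced increments summed over fine subdivisions, replaces the map to the circle and
    its degree. *)

Section TreeOfEdges.
Context {E : choiceType} {W : eqType}.
Variables (bar : E -> E) (src : E -> W) (out : W -> seq E).
Hypothesis barK : involutive bar.
Hypothesis mem_out : forall v b, (b \in out v) = (src b == v).
Hypothesis out_uniq : forall v, uniq (out v).

Local Notation tgt b := (src (bar b)).

Inductive avoiding_walk (f : E) (v : W) : W -> Prop :=
| avoiding_walk_nil : avoiding_walk f v v
| avoiding_walk_rcons b : avoiding_walk f v (src b) -> b <> f -> b <> bar f ->
    avoiding_walk f v (tgt b).

Hypothesis bridge : forall f, ~ avoiding_walk f (tgt f) (src f).

Lemma avoiding_walk_trans f u v w :
  avoiding_walk f u v -> avoiding_walk f v w -> avoiding_walk f u w.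
Proof. by move=> uv; elim=> // b _ ub bf bf'; exact: avoiding_walk_rcons. Qed.

Lemma avoiding_walk_sym f u v : avoiding_walk f u v -> avoiding_walk f v u.
Proof.
elim=> [|b _ ub bf bf']; first exact: avoiding_walk_nil.
apply: avoiding_walk_trans ub; rewrite -[X in avoiding_walk _ _ (src X)]barK.
apply: avoiding_walk_rcons; first exact: avoiding_walk_nil.
  by move=> bE; apply: bf'; rewrite -bE barK.
by move=> bE; apply: bf; rewrite -[b]barK bE barK.
Qed.

Lemma avoiding_walk_bar f u v :
  avoiding_walk (bar f) u v -> avoiding_walk f u v.
Proof.
elim=> [|b _ ub bf bf']; first exact: avoiding_walk_nil.
by apply: avoiding_walk_rcons => //; rewrite -[f]barK.
Qed.

Definition children a : seq E := [seq b <- out (tgt a) | b != bar a].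

Lemma childP a b : reflect (src b = tgt a /\ b <> bar a) (b \in children a).
Proof.
rewrite mem_filter mem_out; apply: (iffP andP) => -[].
  by move=> /eqP ? /eqP.
by move=> /eqP ? /eqP.
Qed.

(* The vertices on the positive side of a once a is removed. *)
Definition ahead a v := avoiding_walk a (tgt a) v.

Lemma ahead_tgt a : ahead a (tgt a).
Proof. exact: avoiding_walk_nil. Qed.

Lemma ahead_bar a v : ahead a v -> ~ ahead (bar a) v.
Proof.
move=> av /avoiding_walk_bar; rewrite barK => bv.
by apply: (@bridge a); exact: avoiding_walk_trans av (avoiding_walk_sym bv).
Qed.

Lemma child_neq a b : b \in children a -> b <> a.
Proof.
move=> /childP[ba _] eq_ba; apply: (@bridge a).
by rewrite -{3}eq_ba ba; exact: avoiding_walk_nil.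
Qed.

(** A walk from [tgt b] avoiding [b] that used [a] in either direction would visit [tgt a = src b],
    against [bridge] for [b]. So it also avoids [a], and [b] itself serves as the first step. *)
Lemma ahead_child a b v : b \in children a -> ahead b v -> ahead a v.
Proof.
move=> cab; have [ba bna] := childP _ _ cab; have bn := child_neq cab.
rewrite /ahead; elim=> [|c bc ac cb cb'].
  by apply: avoiding_walk_rcons => //; rewrite ba; exact: avoiding_walk_nil.
have [ca|/eqP can] := eqVneq c a.
  exfalso; apply: (@bridge b); rewrite ba -ca.
  exact: avoiding_walk_rcons.
have [ca|/eqP can'] := eqVneq c (bar a).
  by exfalso; apply: (@bridge b); rewrite ba -ca.
exact: avoiding_walk_rcons.
Qed.

(** Seen from [bar b], the sibling [b'] is a child, so what lies ahead of [b'] lies behind [b]. *)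
Lemma ahead_siblings a b b' v : b \in children a -> b' \in children a ->
  b <> b' -> ahead b v -> ~ ahead b' v.
Proof.
move=> /childP[ba _] /childP[b'a _] bb' bv b'v.
apply: (ahead_bar bv); apply: ahead_child b'v.
by apply/childP; rewrite barK ba b'a; split=> // /esym.
Qed.

Fixpoint level x n : seq E :=
  if n is n'.+1 then flatten [seq children a | a <- level x n'] else [:: x].

Lemma levelSP x n b :
  reflect (exists2 a, a \in level x n & b \in children a) (b \in level x n.+1).
Proof.
apply: (iffP flatten_mapP) => -[a ax ba]; by exists a.
Qed.

Lemma level_add x n m b : b \in level x (n + m) ->
  exists2 a, a \in level x n & b \in level a m.
Proof.
elim: m b => [|m IHm] b; first by rewrite addn0; exists b; rewrite ?mem_head.
rewrite addnS => /levelSP[c /IHm[a ax ca] bc]; exists a => //.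
by apply/levelSP; exists c.
Qed.

Lemma ahead_level x n b v : b \in level x n -> ahead b v -> ahead x v.
Proof.
elim: n b => [|n IHn] b; first by rewrite inE => /eqP ->.
by move=> /levelSP[a /IHn ax /ahead_child ab] /ab.
Qed.

Lemma ahead_level_tgt x n b : b \in level x n -> ahead x (tgt b).
Proof. by move=> /ahead_level; apply; exact: ahead_tgt. Qed.

Lemma ahead_level_src x n b : b \in level x n.+1 -> ahead x (src b).
Proof. by move=> /levelSP[a /ahead_level_tgt + /childP[-> _]]. Qed.

Lemma ahead_level_inj x n b b' v : b \in level x n -> b' \in level x n ->
  ahead b v -> ahead b' v -> b = b'.
Proof.
elim: n b b' => [|n IHn] b b'.
  by rewrite !inE => /eqP -> /eqP ->.
move=> /levelSP[a ax ba] /levelSP[a' a'x b'a'] bv b'v.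
have aa' : a = a' by exact: IHn ax a'x (ahead_child ba bv) (ahead_child b'a' b'v).
move: b'a'; rewrite -aa' => b'a; apply: contrapT => bb'.
exact: (ahead_siblings ba b'a bb' bv b'v).
Qed.

(** If [n < m], the ancestor of [b'] at depth [n] must be [b]; then [tgt b'] is ahead of a child of
    [b] whose source is [tgt b], which [bridge] forbids for that child. *)
Lemma level_tgt_inj x n m b b' : b \in level x n -> b' \in level x m ->
  tgt b = tgt b' -> n = m /\ b = b'.
Proof.
wlog nm : n m b b' / (n <= m)%N.
  move=> IH bx b'x bb'; have [nm|/ltnW mn] := leqP n m; first exact: IH.
  by have [-> ->] := IH _ _ _ _ mn b'x bx (esym bb').
move=> bx b'x bb'; have b'b : ahead b (tgt b') by rewrite -bb'; exact: ahead_tgt.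
move: nm; rewrite leq_eqVlt => /orP[/eqP nm|nm].
  split=> //; rewrite -nm in b'x.
  exact: (ahead_level_inj bx b'x b'b (ahead_tgt _)).
exfalso; move: b'x; rewrite -(subnKC nm) addSnnS => /level_add[a ax].
rewrite -add1n => b'a.
have ab : b = a by apply: (ahead_level_inj bx ax b'b); exact: ahead_level_tgt b'a.
move: b'a => /level_add[c]; rewrite -ab => /levelSP[_ /[!inE] /eqP -> cb].
move=> /ahead_level_tgt; rewrite -bb'.
by have [<- _] := childP _ _ cb; exact: bridge.
Qed.

Lemma level_bar x n m b : b \in level x n -> bar b \notin level x m.
Proof.
move=> bx; apply/negP; case: m => [|m].
  rewrite inE => /eqP bE; apply: (@bridge x).
  by rewrite -{3}bE; exact: (ahead_level_tgt bx).
move=> /levelSP[a ax /childP[ba nba]].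
by have [_ ab] := level_tgt_inj bx ax ba; apply: nba; rewrite ab.
Qed.

Lemma level_uniq x n : uniq (level x n).
Proof.
elim: n => // n IHn /=.
suff flat_uniq s : uniq s -> {subset s <= level x n} ->
    uniq (flatten [seq children a | a <- s]) by exact: flat_uniq.
elim: s => //= a s IHs /andP[as_ us] sub.
rewrite cat_uniq filter_uniq//=; apply/andP; split; last first.
  by apply: IHs => // b bs; apply: sub; rewrite inE bs orbT.
apply/hasPn => b /flatten_mapP[a' a's ba']; apply/negP => ba.
move/negP: as_; apply; suff -> : a = a' by [].
apply: (@ahead_level_inj x n _ _ (tgt b)).
- by apply: sub; rewrite mem_head.
- by apply: sub; rewrite inE a's orbT.
- by apply: ahead_child (ahead_tgt b).
- by apply: ahead_child (ahead_tgt b).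
Qed.

(** The levels of [bar x] lead away from [x] backwards, whence the reversal by [map bar]. At [n = 0]
    both sides are [x] itself, which must be listed once. *)
Definition forward x n : seq E :=
  level x n ++ (if n is 0 then [::] else map bar (level (bar x) n)).

Lemma forwardP x n b :
  reflect (b \in level x n \/ bar b \in level (bar x) n) (b \in forward x n).
Proof.
rewrite mem_cat; case: n => [|n].
  rewrite !inE orbF; apply: (iffP idP) => [->|]; first by left.
  by move=> [//|/eqP /(can_inj barK) ->].
rewrite [X in _ || X](_ : _ = (bar b \in level (bar x) n.+1)); first exact: orP.
by rewrite -{1}[b]barK mem_map//; exact: can_inj.
Qed.

(** Targets in the levels of [x] lie ahead of [x], those in the levels of [bar x] behind it. So an
    unoriented edge occurs for at most one [n], and in one direction only; summing over an
    orientation level by level rests on this. *)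
Lemma forward_inj x n m b b' : b \in forward x n -> b' \in forward x m ->
  b' = b \/ b' = bar b -> n = m /\ b = b'.
Proof.
have mixed n' m' c : c \in level x n' -> bar c \in level (bar x) m' -> n' = m'.
  case: n' => [|n']; last first.
    move=> /ahead_level_src xc /ahead_level_tgt; rewrite barK.
    by move=> /(ahead_bar xc).
  rewrite inE => /eqP -> bx.
  by have [] := level_tgt_inj (mem_head _ _ : bar x \in level (bar x) 0) bx erefl.
have opp n' m' c : c \in level x n' -> c \notin level (bar x) m'.
  by move=> /ahead_level_tgt xc; apply/negP => /ahead_level_tgt /(ahead_bar xc).
move=> /forwardP[bx|bx] /forwardP[bx'|bx'] [b'b|b'b]; subst b'.
- exact: (level_tgt_inj bx bx').
- by have /negP := level_bar m bx.
- by split=> //; exact: mixed bx'.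
- by move: bx'; rewrite barK => bx'; have /negP := opp _ m _ bx.
- by split=> //; apply/esym; exact: mixed bx.
- by have /negP := opp _ n _ bx'.
- by have [-> _] := level_tgt_inj bx bx' erefl.
- by have := level_bar m bx; rewrite bx'.
Qed.

Lemma forward_uniq x n : uniq (forward x n).
Proof.
rewrite /forward; case: n => // n.
rewrite cat_uniq (map_inj_uniq (can_inj barK)) !level_uniq andbT andTb.
apply/hasPn => _ /mapP[c /ahead_level_src xc ->]; apply/negP.
by move=> /ahead_level_tgt; rewrite barK => /ahead_bar.
Qed.

(** * Conservation of a harmonic flow across the levels *)

Section Flow.
Context {R : realType}.
Variable q : nat.
Hypothesis out_size : forall b, size (out (src b)) = q.+1.

Lemma out_children a : perm_eq (out (tgt a)) (bar a :: children a).
Proof.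
rewrite /children -rem_filter//; apply: perm_to_rem.
by rewrite mem_out.
Qed.

Lemma size_children a : size (children a) = q.
Proof.
by have /perm_size := out_children a; rewrite out_size /= => -[].
Qed.

Variable z : E -> R.
Hypothesis z_bar : forall b, z (bar b) = - z b.
Hypothesis z_flow : forall v, \sum_(b <- out v) z b = 0.

Lemma sum_children a : \sum_(b <- children a) z b = z a.
Proof.
have := z_flow (tgt a); rewrite (perm_big _ (out_children a)) /= big_cons z_bar.
by rewrite addrC => /subr0_eq.
Qed.

Lemma sum_level x n : \sum_(b <- level x n) z b = z x.
Proof.
elim: n => [|n IHn] /=; first by rewrite big_seq1.
rewrite big_flatten big_map -IHn; apply: eq_bigr => a _; exact: sum_children.
Qed.

(** Each side of [x] carries the whole flow [z x]. The multiplicity is 1 at [n = 0], where the two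
    sides coincide, and 2 beyond. *)
Lemma sum_forward x n : \sum_(b <- forward x n) z b = z x *+ (n != 0)%N.+1.
Proof.
rewrite big_cat sum_level; case: n => [|n] /=; first by rewrite big_nil addr0.
rewrite big_map (eq_bigr (fun b => - z b)); last by move=> b _.
by rewrite sumrN (sum_level _ n.+1) z_bar opprK -mulr2n.
Qed.

End Flow.

Section RadialFlow.
Context {R : realType}.
Variables (q : nat) (x : E).
Hypothesis q_gt0 : (0 < q)%N.
Hypothesis out_size : forall b, size (out (src b)) = q.+1.

(** The level chosen by [cid] is unambiguous by [forward_inj]. Edges on no level get 0, and [radial]
    antisymmetrises the result. *)
Let weight b : R :=
  if pselect (exists n, b \in forward x n) is left p
  then (q%:R ^- (projT1 (cid p))) else 0.

Definition radial b : R := weight b - weight (bar b).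

Lemma radial_bar b : radial (bar b) = - radial b.
Proof. by rewrite /radial barK opprB. Qed.

Lemma radial_forward n b : b \in forward x n -> radial b = q%:R ^- n.
Proof.
move=> bx; rewrite /radial /weight; case: pselect => [p|[]]; last by exists n.
case: pselect => [[m bx']|_].
  exfalso; have [_ bb] := forward_inj bx bx' (or_intror erefl).
  move: bx => /forwardP[bx|bx].
    by have := level_bar n bx; rewrite -bb bx.
  by have := level_bar n bx; rewrite -bb bx.
rewrite subr0; case: (cid p) => m bx' /=.
by have [-> _] := forward_inj bx' bx (or_introl erefl).
Qed.

Lemma radial_eq0 b : (forall n, b \notin forward x n) ->
  (forall n, bar b \notin forward x n) -> radial b = 0.
Proof.
move=> bx bx'; rewrite /radial /weight.
case: pselect => [p|_]; first by have [n nx] := p; have /negP := bx n.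
case: pselect => [p|_]; last by rewrite subrr.
by have [n nx] := p; have /negP := bx' n.
Qed.

Lemma radial_flow v : \sum_(b <- out v) radial b = 0.
Proof.
have q0 : q%:R != 0 :> R by rewrite pnatr_eq0 -lt0n.
(* The flow [c] arriving through [a] is shared equally by its [q] children. *)
have step a (c : R) : radial a = c -> {in children a, forall b, radial b = c / q%:R} ->
    \sum_(b <- out (tgt a)) radial b = 0.
  move=> ac bc; rewrite (perm_big _ (out_children a)) /= big_cons radial_bar ac.
  rewrite big_seq_cond (eq_bigr (fun=> c / q%:R)); last first.
    by move=> b; rewrite andbT => /bc.
  rewrite -big_seq_cond big_const_seq count_predT (size_children out_size).
  rewrite iter_addr_0 -[c / _ *+ _]mulr_natr divfK//.
  by rewrite addNr.
have [[a [n [ax <-]]]|nv] := pselect (exists a n, a \in level x n /\ tgt a = v).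
  apply: (step a (q%:R ^- n)); first by apply: radial_forward; apply/forwardP; left.
  move=> b ba; rewrite -invfM -exprSr; apply: radial_forward.
  by apply/forwardP; left; apply/levelSP; exists a.
have [[a [n [ax <-]]]|nv'] :=
    pselect (exists a n, a \in level (bar x) n /\ tgt a = v).
  apply: (step a (- q%:R ^- n)).
    rewrite -[a in LHS]barK radial_bar (@radial_forward n)//.
    by apply/forwardP; right; rewrite barK.
  move=> b ba; rewrite mulNr -invfM -exprSr -[b]barK radial_bar.
  congr (- _); apply: radial_forward; apply/forwardP; right; rewrite barK.
  by apply/levelSP; exists a.
(* At a vertex where no edge of the levels ends, only a root [x] or [bar x] could start, since any
   other edge of a level starts where its parent ends; and a root starts where the opposite root
   ends. *)
have no_parent y n b : b \in level y n -> src b = v ->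
    (forall a m, a \in level y m -> tgt a <> v) -> n = 0%N /\ b = y.
  case: n => [|n]; first by rewrite inE => /eqP ->.
  by move=> /levelSP[a ay /childP[-> _]] av /(_ _ _ ay) /(_ av).
have vx a m : a \in level x m -> tgt a <> v by move=> ax av; apply: nv; exists a, m.
have vx' a m : a \in level (bar x) m -> tgt a <> v.
  by move=> ax av; apply: nv'; exists a, m.
rewrite big_seq; apply: big1 => b; rewrite mem_out => /eqP bv.
apply: radial_eq0 => n; apply/negP => /forwardP[bx|bx].
- have [_ bE] := no_parent _ _ _ bx bv vx.
  by apply: (vx' (bar x) 0%N); rewrite ?mem_head// barK -bE.
- by apply: (vx' _ _ bx); rewrite barK.
- by apply: (vx _ _ bx); rewrite barK.
- rewrite barK in bx.
  have [_ bE] := no_parent _ _ _ bx bv vx'.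
  by apply: (vx x 0%N); rewrite ?mem_head// -bE.
Qed.

End RadialFlow.
End TreeOfEdges.

(** * Series over an orientation *)

Section OrientedSums.
Context {E : choiceType} {R : realType}.
Variables (bar : E -> E) (O : set E) (F : nat -> seq E).
Hypothesis barK : involutive bar.
Hypothesis orientO : forall b, O (bar b) <-> ~ O b.
Hypothesis F_uniq : forall n, uniq (F n).
Hypothesis F_inj : forall n m b b', b \in F n -> b' \in F m ->
  b' = b \/ b' = bar b -> n = m /\ b = b'.

Definition carried (S : nmodType) (G : E -> S) : Prop :=
  forall b, (forall n, b \notin F n) -> (forall n, bar b \notin F n) -> G b = 0.

(** Replacing each edge by its representative in [O] sends the levels to disjoint finite subsets of
    [O]; the rest of [O] contributes 0 by [carried]. *)
Lemma esum_orientation (G : E -> \bar R) : (forall b, 0 <= G b)%E ->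
  (forall b, G (bar b) = G b) -> carried G ->
  (\esum_(b in O) G b = \sum_(0 <= n <oo) \sum_(b <- F n) G b)%E.
Proof.
move=> G0 Gbar GF; pose orient b := if b \in O then b else bar b.
have orientP b : O (orient b).
  by rewrite /orient; case: ifPn; [rewrite inE|rewrite notin_setE => /orientO].
have orientE b : orient b = b \/ orient b = bar b.
  by rewrite /orient; case: ifP; [left|right].
have orientG b : G (orient b) = G b.
  by have [->|->] := orientE b; rewrite ?Gbar.
have orient_eq b b' : orient b' = orient b -> b' = b \/ b' = bar b.
  have [->|->] := orientE b; have [->|->] := orientE b'.
  - by left.
  - by move=> <-; right; rewrite barK.
  - by right.
  - by move=> /(can_inj barK); left.
pose J n := orient @` [set` F n].
have tJ : trivIset [set: nat] J.
  move=> n m _ _ [_ [[b bn <-] [b' b'm /orient_eq]]].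
  by move=> /(F_inj bn b'm)[].
transitivity (\esum_(b in \bigcup_n J n) G b).
  rewrite esum_mkcond [RHS]esum_mkcond; apply: eq_esum => b _.
  have [|] := ifPn; have [|] := ifPn => //.
  - rewrite notin_setE inE => nJ Ob; apply: GF => n; apply/negP => bn; apply: nJ;
      exists n => //.
      by exists b => //; rewrite /orient mem_set.
    exists (bar b) => //; rewrite /orient ifN ?barK// notin_setE.
    by move=> /orientO; apply.
  - by rewrite inE notin_setE => -[n _ [c _ <-]] /(_ (orientP c)).
rewrite nneseries_sum_bigcup//; apply: eq_eseriesr => n _.
rewrite esum_image; last first.
  move=> b b' /set_mem bn /set_mem b'n bb'.
  by have [] := F_inj bn b'n (orient_eq _ _ (esym bb')).
rewrite (eq_esum (fun b _ => orientG b)) esum_fset//.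
by rewrite -fsbig_seq.
Qed.

(** Summability allows a series with signs to be regrouped: the positive and negative parts are
    regrouped separately, and the difference of their limits is the limit [L] of the level sums. *)
Lemma esum_orientationB (p : E -> R) (L : R) :
  (forall b, p (bar b) = p b) -> carried p ->
  summable O (EFin \o p) ->
  \sum_(0 <= n < N) \sum_(b <- F n) p b @[N --> \oo] --> L ->
  let f := fun b => (p b)%:E in
  (\esum_(b in O) f^\+ b - \esum_(b in O) f^\- b = L%:E)%E.
Proof.
move=> pbar pF pO pL f.
have part (r : E -> R) : (forall b, 0 <= r b) -> (forall b, r (bar b) = r b) ->
    carried r -> (\esum_(b in O) (r b)%:E < +oo)%E ->
  exists2 A : R, (\esum_(b in O) (r b)%:E = A%:E)%E &
    \sum_(0 <= n < N) \sum_(b <- F n) r b @[N --> \oo] --> A.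
  move=> r0 rbar rF rO; exists (fine (\esum_(b in O) (r b)%:E)).
    by rewrite fineK// ge0_fin_numE// esum_ge0// => b _; rewrite lee_fin.
  have -> : (fun N => \sum_(0 <= n < N) \sum_(b <- F n) r b) =
      fine \o (fun N => \sum_(0 <= n < N) \sum_(b <- F n) (r b)%:E)%E.
    apply/funext => N /=; rewrite -[LHS]/(fine _%:E) -sumEFin; congr fine.
    by apply: eq_bigr => n _; rewrite sumEFin.
  apply: fine_cvg; rewrite fineK; last first.
    by rewrite ge0_fin_numE// esum_ge0// => b _; rewrite lee_fin.
  rewrite esum_orientation => [|b|b|b bF bF']; last first.
  - by rewrite rF.
  - by rewrite rbar.
  - by rewrite lee_fin.
  by apply: is_cvg_nneseries => n _ _; apply: sume_ge0 => b _; rewrite lee_fin.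
have fpos : f^\+%E = fun b => (Num.max (p b) 0)%:E.
  by apply/funext => b; rewrite funeposE -EFin_max.
have fneg : f^\-%E = fun b => (Num.max (- p b) 0)%:E.
  by apply/funext => b; rewrite funenegE -EFin_max.
have [A EA cA] : exists2 A : R, (\esum_(b in O) f^\+ b = A%:E)%E &
    \sum_(0 <= n < N) \sum_(b <- F n) Num.max (p b) 0 @[N --> \oo] --> A.
  rewrite fpos; apply: part => [b|b|b bF bF'|]; first by rewrite le_max lexx orbT.
  - by rewrite pbar.
  - by rewrite pF// maxxx.
  - rewrite -fpos; apply: le_lt_trans (summable_funepos pO).
    by apply: le_esum => b _; exact: lee_abs.
have [B EB cB] : exists2 B : R, (\esum_(b in O) f^\- b = B%:E)%E &
    \sum_(0 <= n < N) \sum_(b <- F n) Num.max (- p b) 0 @[N --> \oo] --> B.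
  rewrite fneg; apply: part => [b|b|b bF bF'|]; first by rewrite le_max lexx orbT.
  - by rewrite pbar.
  - by rewrite pF// oppr0 maxxx.
  - rewrite -fneg; apply: le_lt_trans (summable_funeneg pO).
    by apply: le_esum => b _; exact: lee_abs.
rewrite EA EB -EFinB; congr EFin; apply: (cvg_unique _ _ pL) => //.
rewrite (_ : (fun N => _) = (fun N =>
    \sum_(0 <= n < N) \sum_(b <- F n) Num.max (p b) 0 -
    \sum_(0 <= n < N) \sum_(b <- F n) Num.max (- p b) 0)); first exact: cvgB.
apply/funext => N; rewrite -sumrB; apply: eq_bigr => n _.
rewrite -sumrB; apply: eq_bigr => b _.
by case: (leP (p b) 0) => ?; case: (leP (- p b) 0) => ?; lra.
Qed.

End OrientedSums.

(** * The projection of de *)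

Lemma cvg_series_eseries (R : realType) (u : R^nat) (L : R) :
  \sum_(0 <= n < N) u n @[N --> \oo] --> L ->
  (\sum_(0 <= n <oo) (u n)%:E = L%:E)%E.
Proof.
move=> uL; apply/cvg_lim => //.
rewrite (_ : (fun N => _) = EFin \o (fun N => \sum_(0 <= n < N) u n)).
  by apply: cvg_EFin uL; exact: nearW.
by apply/funext => N /=; rewrite sumEFin.
Qed.

Lemma coefB (R : realType) (T : pmetricType R) (V : set T)
    (w h : oriented_edge V -> R) b :
  coef (fun e => w e - h e) b = coef w b - coef h b.
Proof. by rewrite /coef mulrBl. Qed.

Lemma oriented_edge_ext (R : realType) (T : pmetricType R) (V : set T)
    (e e' : oriented_edge V) : elen e = elen e' -> epar e = epar e' -> e = e'.
Proof.
case: e => l g g1 g2 g3 g4 g5; case: e' => l' g' h1 h2 h3 h4 h5 /= ll gg.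
move: h1 h2 h3 h4 h5; rewrite -ll -gg => h1 h2 h3 h4 h5.
by congr OrientedEdge; exact: Prop_irrelevance.
Qed.

Lemma ebarK (R : realType) (T : pmetricType R) (V : set T) :
  involutive (@ebar R T V).
Proof.
move=> e; apply: oriented_edge_ext => //=.
by apply/funext => t; rewrite /rpar /= /rpar /= subKr.
Qed.

Lemma eminus_ebar (R : realType) (T : pmetricType R) (V : set T)
  (e : oriented_edge V) : eminus (ebar e) = eplus e.
Proof. by rewrite /eminus /= /rpar subr0. Qed.

Lemma eplus_ebar (R : realType) (T : pmetricType R) (V : set T)
  (e : oriented_edge V) : eplus (ebar e) = eminus e.
Proof. by rewrite /eplus /= /rpar subrr. Qed.

Section TreeProjection.
Context {R : realType} {T : pmetricType R} {V : set T}.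
Implicit Types (w z h u : oriented_edge V -> R).
Variables (O : set (oriented_edge V)) (x : oriented_edge V).
Variables (out : T -> seq (oriented_edge V)) (q : nat) (l : R).
Hypothesis orientO : orientation O.
Hypothesis mem_out : forall v b, (b \in out v) = (eminus b == v).
Hypothesis out_uniq : forall v, uniq (out v).
Hypothesis eminusV : forall b : oriented_edge V, V (eminus b).
Hypothesis bridge : forall f : oriented_edge V,
  ~ avoiding_walk (@ebar R T V) (@eminus R T V) f (eplus f) (eminus f).
Hypothesis q_gt1 : (1 < q)%N.
Hypothesis out_size : forall b : oriented_edge V, size (out (eminus b)) = q.+1.
Hypothesis elenE : forall b : oriented_edge V, elen b = l.

Local Notation bar := (@ebar R T V).
Local Notation forward := (@forward _ _ bar (@eminus R T V) out x).
Local Notation radial := (@radial _ _ bar (@eminus R T V) out R q x).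

Let q_gt0 : (0 < q)%N. Proof. exact: ltnW. Qed.

Let bridge' f : ~ avoiding_walk bar (@eminus R T V) f (eminus (bar f)) (eminus f).
Proof. by rewrite eminus_ebar; exact: bridge. Qed.

Let l_gt0 : 0 < l.
Proof. by rewrite -(elenE x); case: (epar_unit x). Qed.

Let l_neq0 : l != 0. Proof. by rewrite gt_eqF. Qed.

Lemma coef_bar w b : is_form w -> coef w (bar b) = - coef w b.
Proof. by move=> wf; rewrite /coef wf /= mulNr. Qed.

(** An edge of [O] ending at [v] is the reverse of an edge leaving [v] that is not in [O], so the
    two sums over [O] merge, up to sign, into one over all outgoing edges. Off [V] there are no
    outgoing edges. *)
Lemma harmonic_formP w : is_form w ->
  harmonic_form O w <-> forall v, \sum_(b <- out v) coef w b = 0.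
Proof.
move=> wf.
have barO b : (bar b \in O) = (b \notin O).
  by apply/idP/idP; rewrite notin_setE inE => /orientO.
have flowE v :
    \sum_(e \in O `&` [set e | eplus e = v]) coef w e
    - \sum_(e \in O `&` [set e | eminus e = v]) coef w e =
    - \sum_(b <- out v) coef w b.
  rewrite (_ : _ `&` [set e | eminus e = v] = [set` [seq b <- out v | b \in O]]).
    rewrite -fsbig_seq ?filter_uniq//.
    rewrite (_ : _ `&` _ = [set` [seq bar b | b <- [seq b <- out v | b \notin O]]]).
      rewrite -fsbig_seq; last first.
        by rewrite (map_inj_uniq (can_inj (@ebarK _ _ _))) filter_uniq.
      rewrite big_map !big_filter (bigID [pred b | b \in O] xpredT)/=.
      rewrite (eq_bigr (fun b => - coef w b)); last by move=> b _; exact: coef_bar.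
      by rewrite sumrN opprD addrC.
    apply/seteqP; split=> b /=.
      move=> [Ob bv]; apply/mapP; exists (bar b); last by rewrite ebarK.
      rewrite mem_filter -barO ebarK mem_set// mem_out.
      by rewrite eminus_ebar; apply/eqP.
    move=> /mapP[c + ->]; rewrite mem_filter -barO mem_out => /andP[/set_mem Oc /eqP <-].
    by split=> //; rewrite eplus_ebar.
  apply/seteqP; split=> b /=; rewrite mem_filter mem_out.
    by move=> [Ob bv]; rewrite mem_set//; apply/eqP.
  by move=> /andP[/set_mem Ob /eqP].
split=> [wh v|wv v _]; last by rewrite flowE wv oppr0.
have [Vv|nVv] := pselect (V v).
  by apply/eqP; rewrite -oppr_eq0 -flowE wh.
rewrite big_seq big1// => b; rewrite mem_out => /eqP bv.
by exfalso; apply: nVv; rewrite -bv.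
Qed.

Lemma pairing_self w :
  pairing O w w = (\esum_(b in O) (coef w b ^+ 2 * l)%:E)%E.
Proof.
rewrite /pairing.
have F0 b : (0 <= (coef w b * coef w b * elen b)%:E)%E.
  by rewrite lee_fin elenE -expr2 mulr_ge0 ?sqr_ge0// ltW.
rewrite [X in (_ - X)%E]esum1 ?sube0; last first.
  by move=> b _; rewrite funenegE; apply/max_idPr; rewrite leeNl oppe0.
apply: eq_esum => b _; rewrite funeposE elenE -expr2; apply/max_idPl.
by rewrite lee_fin mulr_ge0 ?sqr_ge0// ltW.
Qed.

Lemma summable_coef w z : (pairing O w w < +oo)%E -> (pairing O z z < +oo)%E ->
  summable O (EFin \o (fun b => coef w b * coef z b * l)).
Proof.
rewrite !pairing_self => wL zL; rewrite /summable.
apply: (@le_lt_trans _ _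
  (\esum_(b in O) ((coef w b ^+ 2 * l)%:E + (coef z b ^+ 2 * l)%:E))%E).
  apply: le_esum => b _; rewrite /= lee_fin -mulrDl normrM (gtr0_norm l_gt0).
  rewrite ler_pM2r// normrM -(real_normK (num_real (coef w b))).
  rewrite -(real_normK (num_real (coef z b))).
  have := normr_ge0 (coef w b); have := normr_ge0 (coef z b); nra.
rewrite esumD; last 2 first.
- by move=> b _; rewrite lee_fin mulr_ge0 ?sqr_ge0// ltW.
- by move=> b _; rewrite lee_fin mulr_ge0 ?sqr_ge0// ltW.
by rewrite lte_add_pinfty.
Qed.

Let radial_bar b : radial (bar b) = - radial b.
Proof. by apply: radial_bar; exact: ebarK. Qed.

Let radial_forward n b : b \in forward n -> radial b = q%:R ^- n.
Proof. by apply: radial_forward => //; exact: ebarK. Qed.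

Let radial_carried : carried bar forward radial.
Proof. by move=> b; exact: radial_eq0. Qed.

Let x_forward : x \in forward 0.
Proof. by rewrite inE. Qed.

Let radial_x : radial x = 1.
Proof. by rewrite (radial_forward x_forward) expr0 invr1. Qed.

Let forward_inj n m b b' : b \in forward n -> b' \in forward m ->
  b' = b \/ b' = bar b -> n = m /\ b = b'.
Proof. by apply: forward_inj => //; exact: ebarK. Qed.

Let forward_uniq n : uniq (forward n).
Proof. by apply: forward_uniq => //; exact: ebarK. Qed.

Let K : R := (q%:R + 1) / (q%:R - 1).

Lemma cvg_radial_weights :
  \sum_(0 <= n < N) (q%:R ^- n *+ (n != 0)%N.+1 : R) @[N --> \oo] --> K.
Proof.
have q1 : 1 < q%:R :> R by rewrite ltr1n.
(* The geometric series with first term 2 counts level 0 twice, whence the correction by 1 below. *)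
have geo : \sum_(0 <= n < N) geometric (2 : R) (q%:R^-1) n @[N --> \oo] -->
    2 / (1 - q%:R^-1 : R).
  apply: cvg_geometric_series.
  by rewrite gtr0_norm ?invr_gt0 ?ltr0n// invf_lt1// ltr0n.
have -> : K = 2 / (1 - q%:R^-1) - 1.
  have q0 : q%:R != 0 :> R by rewrite pnatr_eq0 -lt0n.
  have q11 : q%:R - 1 != 0 :> R by rewrite subr_eq0 gt_eqF.
  by rewrite /K; field; rewrite ?q0 ?q11.
rewrite -cvg_shiftS /=.
rewrite (_ : (fun N => _) = (fun N =>
   \sum_(0 <= n < N.+1) geometric (2 : R) q%:R^-1 n - 1)); last first.
  apply/funext => N; rewrite !big_nat_recl//= expr0 invr1 mulr1n mulr1.
  rewrite addrAC -[2]/(1 + 1) addrK; congr (_ + _).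
  by apply: eq_bigr => n _; rewrite exprVn mulr2n mulrDl mul1r.
by apply: cvgB; [rewrite (cvg_shiftS (fun N => \sum_(0 <= n < N) _)) | exact: cvg_cst].
Qed.

Let sum_radial y n : (forall b, y (bar b) = - y b) ->
  (forall v, \sum_(b <- out v) y b = 0) ->
  \sum_(b <- forward n) radial b * y b = y x * (q%:R ^- n *+ (n != 0)%N.+1).
Proof.
move=> ybar yflow; rewrite big_seq.
rewrite (eq_bigr (fun b => q%:R ^- n * y b)); last by move=> b /radial_forward ->.
rewrite -big_seq -mulr_sumr (@sum_forward _ _ bar (@eminus R T V) out) //.
by rewrite !mulrnAr mulrC.
Qed.

Let radial_flow v : \sum_(b <- out v) radial b = 0.
Proof. by apply: radial_flow => //; exact: ebarK. Qed.

Lemma cvg_radial y : (forall b, y (bar b) = - y b) ->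
  (forall v, \sum_(b <- out v) y b = 0) ->
  \sum_(0 <= n < N) \sum_(b <- forward n) radial b * y b @[N --> \oo] --> y x * K.
Proof.
move=> ybar yflow; under eq_fun do under eq_bigr do rewrite sum_radial//.
under eq_fun do rewrite -mulr_sumr.
by apply: cvgM; [exact: cvg_cst | exact: cvg_radial_weights].
Qed.


(** The factor [l] cancels the division by the length in [coef]. *)
Let radial_form : oriented_edge V -> R := fun b => radial b * l.

Let coef_radial b : coef radial_form b = radial b.
Proof. by rewrite /coef elenE mulfK. Qed.

Let sum_constM (r : oriented_edge V -> R) (c : R) (N : nat) :
  \sum_(0 <= n < N) \sum_(b <- forward n) r b * c =
  (\sum_(0 <= n < N) \sum_(b <- forward n) r b) * c.
Proof. by rewrite mulr_suml; apply: eq_bigr => n _; rewrite mulr_suml. Qed.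

Lemma radial_harmonic_L2 : harmonic_L2 O radial_form.
Proof.
have rf : is_form radial_form by move=> b; rewrite /radial_form radial_bar mulNr.
split; last by apply/harmonic_formP => // v; under eq_bigr do rewrite coef_radial.
split=> //; rewrite pairing_self (esum_orientation (@ebarK _ _ _) orientO
  forward_uniq forward_inj) => [|b|b|b bF bF'].
- under eq_eseriesr do rewrite sumEFin.
  rewrite (@cvg_series_eseries _ _ (K * l)) ?ltry//.
  under eq_fun do under eq_bigr do under eq_bigr do rewrite coef_radial expr2.
  under eq_fun do rewrite sum_constM.
  apply: cvgM; last exact: cvg_cst.
  by rewrite -[K]mul1r -radial_x; exact: cvg_radial.
- by rewrite lee_fin mulr_ge0 ?sqr_ge0// ltW.
- by rewrite coef_bar// sqrrN.
- by rewrite coef_radial radial_carried// expr0n mul0r.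
Qed.

Let indic_x b : coef (dform x) b = (b == x)%:R - (b == bar x)%:R.
Proof.
have xbar : bar x != x.
  apply/eqP => /(congr1 (fun e => O e)) xx.
  by have := orientO x; rewrite xx; tauto.
rewrite /coef /dform; case: eqVneq => [->|_].
  by rewrite eq_sym (negPf xbar) subr0 elenE divff.
by case: eqP => _; rewrite ?mul0r ?subr0// mulNr sub0r !elenE divff.
Qed.

(** Serves twice: for [h] the radial form over [K] against any harmonic [u], with [y = coef u / K],
    and for [h] the projection against the radial form, with [y = coef h]. Either way the product of
    coefficients is [radial] times a flow, and its level sums converge to [y x * K]. *)
Lemma pairing_dform h u y : is_form h -> is_form u ->
  (forall b, coef h b * coef u b = radial b * y b) ->
  (forall b, y (bar b) = - y b) -> (forall v, \sum_(b <- out v) y b = 0) ->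
  (pairing O h h < +oo)%E -> (pairing O u u < +oo)%E ->
  pairing O (fun e => dform x e - h e) u = ((coef u x - y x * K) * l)%:E.
Proof.
move=> hf uf huy ybar yflow hL uL.
pose d b := ((b == x)%:R - (b == bar x)%:R) * coef u b.
have dE b : coef (fun e => dform x e - h e) b * coef u b * elen b =
    d b * l - coef h b * coef u b * l.
  by rewrite coefB indic_x elenE -!mulrBl.
have dbar b : d (bar b) = d b.
  rewrite /d coef_bar// (can_eq (@ebarK _ _ _)) (can2_eq (@ebarK _ _ _) (@ebarK _ _ _)).
  by rewrite mulrN -mulNr opprB.
have dF : carried bar forward d.
  move=> b bF bF'; rewrite /d.
  case: eqP => [bx|_]; first by have /negP := bF 0%N; rewrite bx x_forward.
  case: eqP => [bx|_]; last by rewrite subrr mul0r.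
  by have /negP := bF' 0%N; rewrite bx ebarK x_forward.
have d_eq0 n b : b \in forward n.+1 -> d b = 0.
  move=> bn; rewrite /d.
  case: eqP => [bx|_]; first by have [] := forward_inj x_forward bn (or_introl bx).
  case: eqP => [bx|_]; last by rewrite subrr mul0r.
  by have [] := forward_inj x_forward bn (or_intror bx).
have d_x : d x = coef u x.
  by rewrite /d -indic_x {1}/coef /dform eqxx elenE divff// mul1r.
(* Only level 0, which is the list of [x] alone, contributes. Here [f] will be [id] for the value of
   the series and the absolute value of [t * l] for its summability. *)
have sum_d (f : R -> R) N : f 0 = 0 ->
    \sum_(0 <= n < N.+1) \sum_(b <- forward n) f (d b) = f (coef u x).
  move=> f0; rewrite big_nat_recl// [X in X + _]big_seq1 d_x big1 ?addr0// => n _.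
  by rewrite big_seq big1// => b /d_eq0 ->.
have cvg_d (f : R -> R) : f 0 = 0 ->
    \sum_(0 <= n < N) \sum_(b <- forward n) f (d b) @[N --> \oo] --> f (coef u x).
  move=> f0; rewrite -cvg_shiftS/=.
  by under eq_fun do rewrite sum_d//; exact: cvg_cst.
have sd : summable O (EFin \o (fun b => d b * l)).
  rewrite /summable (esum_orientation (@ebarK _ _ _) orientO
    forward_uniq forward_inj) => [|b|b|b bF bF'].
  - under eq_eseriesr do rewrite sumEFin.
    by rewrite (cvg_series_eseries (cvg_d (fun t => `|t * l|) _)) ?ltry// mul0r normr0.
  - exact: abse_ge0.
  - by rewrite /= dbar.
  - by rewrite /= dF// mul0r normr0.
have shu := summable_coef hL uL.
rewrite /pairing (esum_orientationB (@ebarK _ _ _) orientO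
  forward_uniq forward_inj (L := (coef u x - y x * K) * l))//.
- by move=> b; rewrite !dE dbar !coef_bar// mulrNN.
- by move=> b bF bF'; rewrite dE dF// huy radial_carried// !mul0r subr0.
- rewrite (_ : EFin \o _ = (fun b => (d b * l)%:E - (coef h b * coef u b * l)%:E)%E).
    exact: summableB.
  by apply/funext => b; rewrite /= dE.
rewrite mulrBl; under eq_fun do under eq_bigr do
  (under eq_bigr do rewrite dE huy; rewrite sumrB).
under eq_fun do rewrite sumrB !sum_constM.
apply: cvgB; (apply: cvgM; last exact: cvg_cst); last exact: cvg_radial.
exact: (cvg_d id).
Qed.

Lemma coef_harmonic_proj :
  coef (harmonic_proj O (dform x)) x = (q%:R - 1) / (q%:R + 1).
Proof.
have [radL radH] := radial_harmonic_L2; have [radf radP] := radL.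
have q0 : q%:R + 1 != 0 :> R by rewrite natr1 pnatr_eq0.
have q1 : q%:R - 1 != 0 :> R by rewrite subr_eq0 pnatr_eq1 gt_eqF.
(* [harmonic_proj] is an [xget] with default 0, so its defining property is available only once a
   projection has been exhibited; the witness is the radial form over [K]. *)
have [H Horth] : let h := harmonic_proj O (dform x) in harmonic_L2 O h /\
    forall z, harmonic_L2 O z -> pairing O (fun e => dform x e - h e) z = 0%E.
  apply: (@xgetPex _ (fun=> 0) [set h | harmonic_L2 O h /\
    forall z, harmonic_L2 O z -> pairing O (fun e => dform x e - h e) z = 0%E]).
  pose h b := radial_form b / K.
  have hE b : coef h b = radial b / K by rewrite /coef mulrAC -/(coef _ _) coef_radial.
  have hf : is_form h by move=> b; rewrite /h radf mulNr.
  have hL : (pairing O h h < +oo)%E.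
    move: radP; rewrite !pairing_self.
    under [in X in X -> _]eq_esum do rewrite coef_radial.
    apply: le_lt_trans; apply: le_esum => b _.
    rewrite hE lee_fin exprMn ler_pM2r// ler_piMr ?sqr_ge0//.
    have q1' : 0 < q%:R - 1 :> R by rewrite subr_gt0 ltr1n.
    (* Dividing by [K] does not increase the norm, so [h] inherits square-integrability from the
       radial form. *)
    have K1 : 1 <= K by rewrite ler_pdivlMr// mul1r lerD2l; lra.
    by rewrite exprVn invf_le1 ?exprn_gt0 ?exprn_ege1// (lt_le_trans _ K1).
  exists h; split.
    split=> //; apply/harmonic_formP => // v.
    by under eq_bigr do rewrite hE; rewrite -mulr_suml radial_flow mul0r.
  move=> z [[zf zL] zH].
  rewrite (@pairing_dform h z (fun b => coef z b / K))//.
  - by rewrite divfK ?subrr ?mul0r// mulf_neq0// invr_eq0.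
  - by move=> b; rewrite hE mulrAC mulrA.
  - by move=> b; rewrite coef_bar// mulNr.
  - by move=> v; rewrite -mulr_suml (harmonic_formP zf).1// mul0r.
(* Orthogonality to the radial form alone determines the coefficient, so that
   uniqueness of the projection is not needed. *)
have [[hf hL] hH] := H.
have := Horth _ radial_harmonic_L2.
rewrite (@pairing_dform _ _ (coef (harmonic_proj O (dform x))))//.
- rewrite coef_radial radial_x => -[] /eqP; rewrite mulf_eq0 (negPf l_neq0) orbF.
  rewrite subr_eq0 => /eqP hK.
  by apply: (@mulIf _ K); rewrite -?hK /K ?mulf_neq0 ?invr_eq0//; field; rewrite q0 q1.
- by move=> b; rewrite coef_radial mulrC.
- by move=> b; rewrite coef_bar.
- by apply/(harmonic_formP hf).
Qed.

End TreeProjection.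

(** * Local structure of metric graphs *)

Lemma nbhs_distP (R : realType) (T : metricType R) (x : T) (P : set T) :
  nbhs x P <-> exists2 e : R, 0 < e & forall y, mdist x y < e -> P y.
Proof.
split=> [/nbhs_ballP[e e0 eP]|[e e0 eP]].
  by exists e => // y xy; apply: eP; rewrite ballEmdist.
by apply/nbhs_ballP; exists e => // y; rewrite /= ballEmdist; exact: eP.
Qed.

Lemma within_distP (R : realType) (X : pseudoMetricType R) (T : metricType R)
    (A : set X) (f : X -> T) :
  {within A, continuous f} <-> forall x, A x -> forall e : R, 0 < e ->
    exists2 d : R, 0 < d & forall y, A y -> ball x d y -> mdist (f x) (f y) < e.
Proof.
rewrite subspace_continuousP; split=> [fc x Ax e e0|fc x Ax U].
  have /(fc x Ax) : nbhs (f x) [set z | mdist (f x) z < e].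
    by apply/nbhs_distP; exists e.
  by move=> /nbhs_ballP[d d0 dP]; exists d => // y Ay xy; exact: dP.
move=> /nbhs_distP[e e0 eU]; have [d d0 dP] := fc x Ax e e0.
apply/nbhs_ballP; exists d => // y xy Ay; apply: eU; exact: dP.
Qed.

Section LebesgueNumber.
Context {R : realType} {X : pseudoMetricType R}.

(** [P] is a hereditary smallness property. It will stand for lying in an evenly covered set with
    isometric sheets, for a local estimate along a path, and for carrying a potential of a discrete
    form. *)
Lemma lebesgue_number (K : set X) (P : set X -> Prop) :
  compact K -> (forall A B, A `<=` B -> P B -> P A) ->
  (forall x, K x -> exists2 U, nbhs x U & P U) ->
  exists2 d : R, 0 < d & forall x, K x -> P (ball x d).
Proof.
move=> /compact_near_coveringP Kc Pmono KP.
have : \forall d \near (0 : R)^'+, K `<=` [set x | P (ball x d)].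
  apply: Kc => x /KP[U /nbhs_ballP[e /= e0 eU] PU].
  exists (ball x (e / 2), [set d | d < e / 2]) => /=.
    split; first by apply: nbhsx_ballx; rewrite divr_gt0.
    by apply: nbhs_right_lt; rewrite divr_gt0.
  move=> [x' d] /= [xx' de]; apply: Pmono PU => y x'y; apply: eU.
  rewrite (splitr e); apply: ball_triangle xx' _.
  by apply: le_ball x'y; exact: ltW.
move=> Kd; near (0 : R)^'+ => d; exists d => //.
by near: d.
Unshelve. all: by end_near. Qed.

End LebesgueNumber.

(** * Path length and path distance *)

Section PathLength.
Context {R : realType} {T : pmetricType R}.
Implicit Types (g : R -> T) (A : set T).

Lemma path_length_lipschitz g (c : R) :
  (forall s t, s \in `[0, 1] -> t \in `[0, 1] -> mdist (g s) (g t) <= c * `|s - t|) ->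
  (path_length g <= c%:E)%E.
Proof.
move=> gc; apply: ge_ereal_sup => _ [s s01 <-]; rewrite lee_fin.
pose v n := nth 1 (0 :: s) n.
have v01 n : (n <= size s)%N -> v n \in `[0, 1].
  by move=> ns; rewrite in_itv/= itv_partition_nth_ge// itv_partition_nth_le.
apply: (@le_trans _ _ (\sum_(0 <= n < size s) (c * v n.+1 - c * v n))); last first.
  rewrite telescope_sumr// -mulrBr /v (itv_partition_nth_size _ s01) subr0 mulr1//.
rewrite big_nat [leRHS]big_nat; apply: ler_sum => n /= ns.
apply: le_trans (gc _ _ (v01 _ (ltnW ns)) (v01 _ ns)) _.
rewrite -mulrBr distrC gtr0_norm// subr_gt0.
by case: s01 => /(pathP 1) + _; exact.
Qed.

(** Over a uniform subdivision finer than [d] the increments of [u] telescope, each dominated by a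
    step of [g]. A local lower bound on the speed thus yields a global lower bound on the length. *)
Lemma path_length_ge_height g (u : R -> R) :
  (exists2 d : R, 0 < d & forall s t, s \in `[0, 1] -> t \in `[0, 1] ->
     `|s - t| < d -> `|u s - u t| <= mdist (g s) (g t)) ->
  (`|u 1%R - u 0%R|%:E <= path_length g)%E.
Proof.
move=> [d d0 ud]; have [N Nd] : exists N : nat, N.+1%:R^-1 < d.
  have [N _ NP] := near_infty_natSinv_lt (PosNum d0).
  by exists N; apply: (NP N) => /=.
pose s : seq R := [seq (i.+1)%:R / N.+1%:R | i <- iota 0 N.+1].
have sN : size s = N.+1 by rewrite size_map size_iota.
have N0 : 0 < N.+1%:R :> R by rewrite ltr0n.
have nth_s n : (n <= N.+1)%N -> nth 1 (0 :: s) n = n%:R / N.+1%:R.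
  case: n => [|n] nN; first by rewrite mul0r.
  by rewrite /= (nth_map 0%N) ?size_iota// nth_iota.
have s01 : itv_partition 0 1 s.
  split.
    apply/(pathP 1) => n; rewrite sN => nN.
    rewrite -[nth 1 s n]/(nth 1 (0 :: s) n.+1) !nth_s//; last exact: ltnW.
    by rewrite ltr_pM2r ?invr_gt0// ltr_nat.
  rewrite -nth_last (set_nth_default 1) sN//= -[nth 1 s N]/(nth 1 (0 :: s) N.+1).
  by rewrite nth_s// divff// gt_eqF.
have in01 n : (n <= N.+1)%N -> n%:R / N.+1%:R \in `[0 : R, 1].
  by move=> nN; rewrite in_itv/= divr_ge0//= ler_pdivrMr// mul1r ler_nat.
apply: (@le_trans _ _ (\sum_(0 <= n < size s)
      mdist (g (nth 1 (0 :: s) n)) (g (nth 1 (0 :: s) n.+1)))%:E); last first.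
  by apply: ereal_sup_ubound; exists s.
rewrite lee_fin sN.
rewrite (_ : u 1 - u 0 = \sum_(0 <= n < N.+1)
    (u (nth 1 (0 :: s) n.+1) - u (nth 1 (0 :: s) n))); last first.
  by rewrite (telescope_sumr (fun n => u (nth 1 (0 :: s) n)))// nth_s// divff// gt_eqF.
apply: le_trans (ler_norm_sum _ _ _) _.
rewrite big_nat [leRHS]big_nat; apply: ler_sum => n /= nN.
rewrite -[nth 1 s n]/(nth 1 (0 :: s) n.+1) !nth_s//; last exact: ltnW.
rewrite distrC; apply: ud; [exact/in01/ltnW|exact: in01|].
by rewrite distrC -mulrBl -natrB// subSnn mul1r gtr0_norm ?invr_gt0.
Qed.

Lemma mdist_le_path_dist A x y : ((mdist x y)%:E <= path_dist A x y)%E.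
Proof.
apply: le_ereal_inf_tmp => _ [g [_ <- <- _] <-].
rewrite -[leLHS]/((mdist (g 0) (g 1))%:E).
apply: ereal_sup_ubound; exists [:: 1]; first exact: itv_partition1.
by rewrite /= big_nat1.
Qed.

Lemma path_dist_lipschitz A g (c : R) : 0 <= c ->
  (forall s t, s \in `[0, 1] -> t \in `[0, 1] -> mdist (g s) (g t) <= c * `|s - t|) ->
  g @` `[0, 1] `<=` A -> (path_dist A (g 0%R) (g 1%R) <= c%:E)%E.
Proof.
move=> c0 gc gA; apply: le_trans (path_length_lipschitz gc).
apply: ereal_inf_lbound; exists g => //; split=> //.
apply/within_distP => s s01 e e0; exists (e / (c + 1)).
  by rewrite divr_gt0// ltr_wpDl.
move=> t t01; rewrite /ball/= => st.
apply: le_lt_trans (gc _ _ _ _) _ => //.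
have c1 : 0 < c + 1 by rewrite ltr_wpDl.
move: st; rewrite ltr_pdivlMr// => st.
have := normr_ge0 (s - t); nra.
Qed.

End PathLength.

Lemma itv_sub_ball (R : realFieldType) (s s' t d c : R) :
  `|s - t| < d -> `|s' - t| < d -> s <= c <= s' -> `|c - t| < d.
Proof. by rewrite !ltr_norml => /andP[? ?] /andP[? ?] /andP[? ?]; apply/andP; split; lra. Qed.

Lemma segment_between (R : realFieldType) (x y a : R) : 0 <= a -> a <= 1 ->
  Num.min x y <= x + a * (y - x) <= Num.max x y.
Proof. by move=> a0 a1; case: (leP x y) => xy; apply/andP; split; nra. Qed.

(** Meant for [a] and [b] the images of [v] and [- v] under an isometry of the line fixing 0, which
    is the identity or the reflection. *)
Lemma isometry_branch (R : realFieldType) (v a b : R) :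
  `|a| = `|v| -> `|b| = `|v| -> `|a - b| = `|v + v| -> a = v \/ b = v.
Proof.
move=> av bv abv; have [->|an] := eqVneq a v; first by left.
have : (a == v) || (a == - v) by rewrite -eqr_norm2 av.
rewrite (negPf an)/= => /eqP aE; right; apply/eqP.
have : (b == v) || (b == - v) by rewrite -eqr_norm2 bv.
move=> /orP[//|/eqP bE]; move: abv; rewrite aE bE subrr normr0 => /esym/eqP.
by rewrite normr_eq0 -mulr2n mulrn_eq0/= => /eqP ->; rewrite oppr0.
Qed.

Section LocalStructure.
Context {R : realType} {T : pmetricType R}.
Implicit Types (x : T) (C V : set T) (g : R -> T) (l t : R).

(** The two rays are placed on opposite half-lines, so that distances through the centre, [s + t] in
    [star_dist], become distances on the line. *)
Lemma valence2_chart x (r : R) : 0 < r -> star_neighborhood x 2 r ->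
  exists L : R -> T, [/\ L 0 = x,
    forall s t, `|s| < r -> `|t| < r -> mdist (L s) (L t) = `|s - t|
    & nbhs x (L @` [set s | `|s| < r])].
Proof.
move=> r0 [sigma [sigma0 sigmaD sigmaN]].
pose i0 : 'I_2 := ord0; pose i1 : 'I_2 := lift ord0 ord0.
have i01 : (i0 == i1) = false by [].
have i10 : (i1 == i0) = false by [].
have in_r s : 0 <= s -> s < r -> s \in `[0, r[ by rewrite in_itv/= => -> ->.
exists (fun s => if 0 <= s then sigma i0 s else sigma i1 (- s)); split.
- by rewrite lexx.
- move=> s t; rewrite !ltr_norml => /andP[sr rs] /andP[tr rt].
  have [s0|s0] := leP 0 s; have [t0|t0] := leP 0 t; rewrite sigmaD ?in_r//; try lra.
  + by rewrite /star_dist i01 ger0_norm//; lra.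
  + by rewrite /star_dist i10 ler0_norm//; lra.
  + by rewrite /star_dist eqxx -opprD normrN.
- apply: filterS sigmaN => y [->|[i _ [s]]].
    by exists 0; rewrite /= ?normr0 ?lexx.
  rewrite /= in_itv/= => /andP[s0 sr] <-.
  have : i = i0 \/ i = i1.
    by case: i => -[|[|//]] ilt; [left|right]; apply: val_inj.
  move=> [->|->]; first by exists s; rewrite ?s0 //= ger0_norm.
  have [->|sn0] := eqVneq s 0.
    by exists 0; rewrite ?normr0 ?lexx//= !sigma0.
  exists (- s); first by rewrite /= normrN ger0_norm.
  by rewrite oppr_ge0 opprK leNgt lt_neqAle eq_sym sn0 s0.
Qed.

Lemma unit_param_lipschitz C l g s t : unit_param C l g ->
  s \in `]0, l[ -> t \in `]0, l[ -> mdist (g s) (g t) <= `|s - t|.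
Proof.
move=> [_ _ gC] s0 t0; rewrite -lee_fin -gC//; exact: mdist_le_path_dist.
Qed.

Lemma path_distxx C x : C x -> path_dist C x x = 0%E.
Proof.
move=> Cx; apply/eqP; rewrite eq_le; apply/andP; split; last first.
  by apply: le_trans (mdist_le_path_dist C x x); rewrite mdistxx.
apply: (@path_dist_lipschitz _ _ C (fun=> x)) => //.
  by move=> s t _ _; rewrite mdistxx mul0r.
by move=> _ [_ _ <-].
Qed.

Lemma unit_param_inj C l g s t : unit_param C l g ->
  s \in `]0, l[ -> t \in `]0, l[ -> g s = g t -> s = t.
Proof.
move=> [_ gC gD] s0 t0 st; have := gD s t s0 t0.
rewrite st path_distxx; last by rewrite -gC; exists t.
by move=> [] /esym/eqP; rewrite normr_eq0 subr_eq0 => /eqP.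
Qed.

(** A priori [g] is only 1-Lipschitz for [mdist]. As [g t] is not a vertex, its star has valence 2
    and gives a chart, in which [g] reads as a real function [u] that turns out to be an
    isometry. *)
Lemma unit_param_local C V l g t : metric_graph T -> vertex_set V ->
  (forall x, C x -> ~ V x) -> unit_param C l g -> t \in `]0, l[ ->
  exists d : R, [/\ 0 < d, forall s, `|s - t| < d -> s \in `]0, l[,
    forall s s', `|s - t| < d -> `|s' - t| < d -> mdist (g s) (g s') = `|s - s'|
    & forall e, 0 < e -> e <= d -> nbhs (g t) (g @` [set s | `|s - t| < e])].
Proof.
move=> [_ [eps eps0 star]] [_ Vval _] CV gC tl.
have [_ gimg gD] := gC; have glip := unit_param_lipschitz gC.
have Cg s : s \in `]0, l[ -> C (g s) by move=> sl; rewrite -gimg; exists s.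
have [n [r [er st]]] := star (g t); have r0 := lt_le_trans eps0 er.
have n2 : n = 2%N.
  apply: contrapT => n2; apply: (CV _ (Cg _ tl)).
  by apply: Vval n2; exists r.
rewrite {}n2 in st; have [L [L0 LD LN]] := valence2_chart r0 st.
have /nbhs_distP[h h0 hL] := LN.
move: (tl); rewrite in_itv/= => /andP[t0 tl'].
(* [h] keeps [g s] inside the chart; the other two bounds keep [s] between 0 and [l]. *)
pose d := Num.min h (Num.min t (l - t)).
have d0 : 0 < d by rewrite !lt_min h0 t0 subr_gt0.
have dl s : `|s - t| < d -> s \in `]0, l[.
  by rewrite !lt_min !ltr_norml in_itv/= => /and3P[_ ? ?]; apply/andP; split; lra.
have : forall s, exists v, `|s - t| < d -> `|v| < r /\ L v = g s.
  move=> s; have [sd|sd] := pselect (`|s - t| < d); last by exists 0.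
  have : (L @` [set s | `|s| < r]) (g s).
    apply: hL; apply: le_lt_trans (glip _ _ tl (dl _ sd)) _.
    by rewrite distrC (lt_le_trans sd)// ge_min lexx.
  by move=> [v vr Lv]; exists v.
move=> /choice[u uP].
have tt : `|t - t| < d by rewrite subrr normr0.
have uD s s' : `|s - t| < d -> `|s' - t| < d ->
    mdist (g s) (g s') = `|u s - u s'|.
  move=> sd s'd; have [ur <-] := uP _ sd; have [ur' <-] := uP _ s'd.
  exact: LD.
have ut : u t = 0.
  have [utr Lut] := uP _ tt.
  have : mdist (L (u t)) (L 0) = `|u t| by rewrite LD ?normr0// subr0.
  by rewrite Lut L0 mdistxx => /esym/eqP; rewrite normr_eq0 => /eqP.
have ulip s s' : `|s - t| < d -> `|s' - t| < d -> `|u s - u s'| <= `|s - s'|.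
  by move=> sd s'd; rewrite -uD//; apply: glip; exact: dl.
have uiso_le s s' : s <= s' -> `|s - t| < d -> `|s' - t| < d ->
    `|s - s'| <= `|u s - u s'|.
  (* The segment of the chart between g s and g s' consists of points of C, by
     the intermediate value theorem, so its length bounds the path distance. *)
  move=> ss' sd s'd; rewrite -lee_fin -gD; [|exact: dl|exact: dl].
  have [us us'] := (uP _ sd, uP _ s'd).
  pose p a := L (u s + a * (u s' - u s)).
  have p0 : p 0 = g s by rewrite /p mul0r addr0; exact: us.2.
  have p1 : p 1 = g s' by rewrite /p mul1r addrC subrK; exact: us'.2.
  have between a : a \in `[0, 1] -> exists2 c, `|c - t| < d &
      u c = u s + a * (u s' - u s).
    rewrite in_itv/= => /andP[a0 a1].
    have [c] : exists2 c, c \in `[s, s'] & u c = u s + a * (u s' - u s).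
      apply: IVT => //.
        apply/(@within_distP R R R^o) => y; rewrite /= in_itv/= => ys e e0.
        exists e => // z; rewrite /= in_itv/= /ball/= => zs; apply: le_lt_trans.
        rewrite -[leLHS]/(`|u z - u y|) distrC.
        by apply: ulip; exact: itv_sub_ball sd s'd _.
      exact: segment_between.
    rewrite in_itv/= => cs uc; exists c => //; exact: itv_sub_ball sd s'd _.
  have pr a : a \in `[0, 1] -> `|u s + a * (u s' - u s)| < r.
    by move=> /between[c cd <-]; have [] := uP _ cd.
  rewrite -p0 -p1; apply: path_dist_lipschitz => //.
    move=> a b a01 b01; rewrite /p LD; [|exact: pr|exact: pr].
    by rewrite opprD addrACA subrr add0r -mulrBl normrM mulrC distrC (distrC (u s)) lexx.
  move=> _ [a /between[c cd uc] <-]; rewrite /p -uc.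
  by have [_ ->] := uP _ cd; apply/Cg/dl.
have uiso s s' : `|s - t| < d -> `|s' - t| < d -> `|u s - u s'| = `|s - s'|.
  move=> sd s'd; apply/eqP; rewrite eq_le ulip//=.
  have [ss'|/ltW ss'] := leP s s'; first exact: uiso_le.
  by rewrite distrC (distrC (u s)); exact: uiso_le.
exists d; split=> //; first by move=> s s' sd s'd; rewrite uD// uiso.
move=> e e0 ed; apply/nbhs_distP; exists e => // y gy.
have [v vr Lv] : (L @` [set s | `|s| < r]) y.
  apply: hL; apply: lt_le_trans gy _; apply: le_trans ed _.
  by rewrite ge_min lexx.
have ve : `|v| < e.
  by move: gy; rewrite -Lv -[g t]L0 LD ?normr0// sub0r normrN.
have vd := lt_le_trans ve ed.
have pv : `|t + v - t| < d by rewrite addrAC subrr add0r.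
have mv : `|t - v - t| < d by rewrite addrAC subrr add0r normrN.
(* Being an isometry with [u t = 0], [u] takes the value [v] at [t + v] or at [t - v]; this puts [y]
   in the image of [g]. *)
have [uv|uv] : u (t + v) = v \/ u (t - v) = v.
  apply: isometry_branch.
  - by have := uiso _ _ pv tt; rewrite ut subr0 addrAC subrr add0r.
  - by have := uiso _ _ mv tt; rewrite ut subr0 addrAC subrr add0r normrN.
  - by rewrite uiso//; congr `|_|; ring.
- exists (t + v); first by rewrite /= addrAC subrr add0r.
  by have [_ <-] := uP _ pv; rewrite uv.
- exists (t - v); first by rewrite /= addrAC subrr add0r normrN.
  by have [_ <-] := uP _ mv; rewrite uv.
Qed.

End LocalStructure.

Lemma itv_approx (R : realFieldType) (l t d : R) : 0 < l -> 0 < d -> 0 <= t <= l ->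
  exists2 t', t' \in `]0, l[ & `|t - t'| < d.
Proof.
move=> l0 d0 /andP[t0 tl]; pose m := Num.min (d / 2) (l / 4).
have m0 : 0 < m by rewrite lt_min !divr_gt0.
have md : m <= d / 2 by rewrite ge_min lexx.
have ml : m <= l / 4 by rewrite ge_min lexx orbT.
have [tl2|tl2] := ltP t (l / 2).
  exists (t + m); first by rewrite in_itv/=; apply/andP; split; lra.
  by rewrite ltr_norml; apply/andP; split; lra.
exists (t - m); first by rewrite in_itv/=; apply/andP; split; lra.
by rewrite ltr_norml; apply/andP; split; lra.
Qed.

Definition clamp (R : realDomainType) (l t : R) : R := Num.max 0 (Num.min t l).

Lemma clamp_in (R : realDomainType) (l t : R) : 0 <= l -> 0 <= clamp l t <= l.
Proof. by move=> l0; rewrite /clamp le_max lexx ge_max l0 ge_min lexx orbT. Qed.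

Lemma clamp_id (R : realDomainType) (l t : R) : 0 <= t <= l -> clamp l t = t.
Proof. by move=> /andP[t0 tl]; rewrite /clamp (min_idPl tl) (max_idPr t0). Qed.

Lemma clamp_lipschitz (R : realFieldType) (l s t : R) :
  `|clamp l s - clamp l t| <= `|s - t|.
Proof.
wlog st : s t / s <= t.
  by move=> H; have [/H//|/ltW/H] := leP s t; rewrite distrC (distrC t).
rewrite (distrC s) (ger0_norm (_ : 0 <= t - s)) ?subr_ge0// ler_norml.
rewrite /clamp /Num.max /Num.min.
case: (ltP s l) => ?; case: (ltP t l) => ?; do 2?case: ltP => ?;
  by apply/andP; split; lra.
Qed.

Lemma continuous_distP (R : realType) (X : pseudoMetricType R) (T : metricType R)
    (f : X -> T) : continuous f <-> forall x, forall e : R, 0 < e ->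
    exists2 d : R, 0 < d & forall y, ball x d y -> mdist (f x) (f y) < e.
Proof.
split=> [fc x e e0|fc].
  have /nbhs_ballP[d d0 dP] : nbhs x (f @^-1` [set z | mdist (f x) z < e]).
    by apply: fc; apply/nbhs_distP; exists e.
  by exists d => // y xy; exact: dP.
move=> x U /nbhs_distP[e e0 eU]; have [d d0 dP] := fc x e e0.
by apply/nbhs_ballP; exists d => // y xy; apply: eU; exact: dP.
Qed.

Lemma lipschitz_continuous (R : realType) (T : metricType R) (f : R -> T) :
  (forall s t, mdist (f s) (f t) <= `|s - t|) -> continuous f.
Proof.
move=> fl; apply/continuous_distP => x e e0; exists e => // y.
by apply: le_lt_trans; exact: fl.
Qed.

(** * Edges as open components with vertices at their ends *)

Section EdgesOfModel.
Context {R : realType} {T : pmetricType R} {V : set T}.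
Implicit Types (x : T) (C : set T) (e : oriented_edge V).

Lemma edge_notin C x : edges V C -> C x -> ~ V x.
Proof. by move=> [y _ ->] /connected_component_sub. Qed.

Lemma edge_component C x : edges V C -> C x -> C = connected_component (~` V) x.
Proof. by move=> [y _ ->]; exact: same_connected_component. Qed.

Lemma component_edge x : ~ V x -> edges V (connected_component (~` V) x).
Proof. by exists x. Qed.

Lemma edges_eq C C' x : edges V C -> edges V C' -> C x -> C' x -> C = C'.
Proof. by move=> VC VC' Cx C'x; rewrite (edge_component VC Cx) (edge_component VC' C'x). Qed.

Lemma elen_gt0 e : 0 < elen e.
Proof. by case: (epar_unit e). Qed.

Lemma epar_edge_set e t : t \in `]0, elen e[ -> edge_set e (epar e t).
Proof. by exists t. Qed.

Lemma epar_notin e t : t \in `]0, elen e[ -> ~ V (epar e t).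
Proof. by move=> /epar_edge_set; exact: edge_notin (epar_edge e). Qed.

Lemma epar_clamp e t : epar e (clamp (elen e) t) = epar e t.
Proof.
have l0 := ltW (elen_gt0 e).
have [t0|/ltW t0] := leP t 0.
  rewrite (epar_left e t0) /clamp (min_idPl (le_trans t0 l0)).
  by rewrite (max_idPl t0).
have [tl|/ltW tl] := leP t (elen e); first by rewrite clamp_id ?t0.
by rewrite (epar_right tl) /clamp (min_idPr tl) (max_idPr l0).
Qed.

(** The interior bound extends to the ends by continuity, and beyond them because [epar] is constant
    there. *)
Lemma epar_lipschitz e s t : mdist (epar e s) (epar e t) <= `|s - t|.
Proof.
have l0 := elen_gt0 e.
rewrite -epar_clamp -(epar_clamp e t); apply: le_trans (clamp_lipschitz (elen e) s t).
move: (clamp_in s (ltW l0)) (clamp_in t (ltW l0)).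
move: (clamp _ s) (clamp _ t) => {}s {}t sl tl.
apply/ler_addgt0Pr => h h0; have h4 : 0 < h / 4 by rewrite divr_gt0.
have approx u : 0 <= u <= elen e -> exists u', [/\ u' \in `]0, elen e[,
    `|u - u'| < h / 4 & mdist (epar e u) (epar e u') < h / 4].
  move=> ul.
  have [d d0 dP] := (continuous_distP (epar e)).1 (@epar_continuous _ _ _ e) u _ h4.
  have m0 : 0 < Num.min d (h / 4) by rewrite lt_min d0.
  have [u' u'l uu'] := itv_approx l0 m0 ul.
  exists u'; split=> //; first by rewrite (lt_le_trans uu')// ge_min lexx orbT.
  by apply: dP; rewrite /ball/= (lt_le_trans uu')// ge_min lexx.
have [s' [s'l ss' Ds]] := approx s sl; have [t' [t'l tt' Dt]] := approx t tl.
have Dst := unit_param_lipschitz (epar_unit e) s'l t'l.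
apply: le_trans (metric_triangle _ (epar e s') _) _.
have := metric_triangle (epar e s') (epar e t') (epar e t).
rewrite (metric_sym (epar e t')) => tri.
have st : `|s' - t'| <= `|s - s'| + `|s - t| + `|t - t'|.
  apply: le_trans (ler_distD s _ _) _; rewrite (distrC s') -addrA lerD2l.
  exact: ler_distD.
move: ss' Ds tt' Dt Dst tri st.
move: (mdist _ _) (mdist _ _) (mdist _ _) (mdist _ _) => a b c d.
move: `|_| `|_| `|_| `|_| => a' b' c' d'; lra.
Qed.

Lemma epar_inj e s t : s \in `]0, elen e[ -> t \in `]0, elen e[ ->
  epar e s = epar e t -> s = t.
Proof. by move=> sl tl; exact: unit_param_inj (epar_unit e) sl tl. Qed.

Lemma edge_set_ebar e : edge_set (ebar e) = edge_set e.
Proof. by rewrite /edge_set /= rpar_image. Qed.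

Hypothesis T_graph : metric_graph T.
Hypothesis V_vertex : vertex_set V.

Lemma edge_open C : edges V C -> open C.
Proof.
move=> VC; have [_ _ /(_ _ VC)[l [g gC]]] := V_vertex.
have [_ gimg _] := gC; rewrite openE => x; rewrite -{1}gimg => -[t tl <-].
have [d [d0 dl _ dN]] := unit_param_local T_graph V_vertex
  (fun x => @edge_notin C x VC) gC tl.
apply: filterS (dN _ d0 (lexx _)) => _ [s sd <-].
by rewrite -gimg; exists s => //; exact: dl.
Qed.

(** Otherwise the initial point would lie in an edge, necessarily [e] itself, say at [epar e t].
    Then [epar e u] with [u] small would also be [epar e v] with [v] close to [t], against
    injectivity. *)
Lemma eminus_vertex e : V (eminus e).
Proof.
apply: contrapT => nVe; have l0 := elen_gt0 e.
pose D := connected_component (~` V) (eminus e).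
have VD : edges V D := component_edge nVe.
have De : D (eminus e) by exact: connected_component_refl.
have [d d0 dD] : exists2 d : R, 0 < d & forall t, `|t| < d -> D (epar e t).
  have /nbhs_ballP[d d0 dD] : nbhs (0 : R) (epar e @^-1` D).
    apply: epar_continuous; apply: open_nbhs_nbhs; split=> //; exact: edge_open.
  by exists d => // t td; apply: dD; rewrite /ball/= sub0r normrN.
have zl : 0 <= (0 : R) <= elen e by rewrite lexx ltW.
have [s sl sd] := itv_approx l0 d0 zl.
rewrite sub0r normrN in sd.
have eD : edge_set e = D.
  by apply: edges_eq VD _ (dD _ sd); [exact: epar_edge|exact: epar_edge_set].
move: De; rewrite -eD => -[t tl et].
have [r [r0 rl _ rN]] := unit_param_local T_graph V_vertex
  (fun x => @edge_notin _ x (epar_edge e)) (epar_unit e) tl.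
have := tl; rewrite /= in_itv/= => /andP[t0 tle].
pose r' := Num.min r (t / 2).
have r'0 : 0 < r' by rewrite lt_min r0 divr_gt0.
have := rN r' r'0; rewrite ge_min lexx => /(_ isT); rewrite et.
move=> /(@epar_continuous _ _ _ e 0) /nbhs_ballP[h h0 hN].
have m0 : 0 < Num.min h (t / 2) by rewrite lt_min h0 divr_gt0.
have [u ul uh] := itv_approx l0 m0 zl.
have [v vr' uv] : (epar e @` [set s | `|s - t| < r']) (epar e u).
  by apply: hN; rewrite /ball/= (lt_le_trans uh)// ge_min lexx.
have vt : `|v - t| < t / 2 by rewrite (lt_le_trans vr')// ge_min lexx orbT.
have vl : v \in `]0, elen e[.
  by apply: rl; rewrite (lt_le_trans vr')// ge_min lexx.
have vu := epar_inj vl ul uv.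
have : `|u| < t / 2.
  by rewrite sub0r normrN in uh; rewrite (lt_le_trans uh)// ge_min lexx orbT.
by move: vt; rewrite vu !ltr_norml => /andP[? ?] /andP[? ?]; lra.
Qed.

Lemma eplus_vertex e : V (eplus e).
Proof. by rewrite -eminus_ebar; exact: eminus_vertex. Qed.

End EdgesOfModel.

Lemma eqr_two_dist (R : realFieldType) (x y m : R) : 0 < m ->
  `|x| = `|y| -> `|x - m| = `|y - m| -> x = y.
Proof.
move=> m0 xy xym; have : (x == y) || (x == - y) by rewrite -eqr_norm2 xy.
move=> /orP[/eqP//|/eqP xE].
have : (x - m == y - m) || (x - m == - (y - m)) by rewrite -eqr_norm2 xym.
by move=> /orP[] /eqP; lra.
Qed.

Lemma itv_translation (R : realFieldType) (l l' c : R) : 0 < l -> 0 < l' ->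
  (forall s, s \in `]0, l[ -> s + c \in `]0, l'[) ->
  (forall t, t \in `]0, l'[ -> t - c \in `]0, l[) -> c = 0 /\ l = l'.
Proof.
move=> l0 l'0 lc l'c.
have c0 : 0 <= c.
  rewrite leNgt; apply/negP => c0.
  have : 0 < Num.min (l / 2) (- c / 2) by rewrite lt_min !divr_gt0// oppr_gt0.
  have : Num.min (l / 2) (- c / 2) <= l / 2 by rewrite ge_min lexx.
  have : Num.min (l / 2) (- c / 2) <= - c / 2 by rewrite ge_min lexx orbT.
  move: (Num.min _ _) => s s1 s2 s3.
  have /lc : s \in `]0, l[ by rewrite in_itv/=; apply/andP; split; lra.
  by rewrite in_itv/= => /andP[]; lra.
have c0' : c <= 0.
  rewrite leNgt; apply/negP => c0'.
  have : 0 < Num.min (l' / 2) (c / 2) by rewrite lt_min !divr_gt0.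
  have : Num.min (l' / 2) (c / 2) <= l' / 2 by rewrite ge_min lexx.
  have : Num.min (l' / 2) (c / 2) <= c / 2 by rewrite ge_min lexx orbT.
  move: (Num.min _ _) => s s1 s2 s3.
  have /l'c : s \in `]0, l'[ by rewrite in_itv/=; apply/andP; split; lra.
  by rewrite in_itv/= => /andP[]; lra.
have {c0 c0'}cE : c = 0 by apply/eqP; rewrite eq_le c0 c0'.
subst c; split=> //; apply/eqP; rewrite eq_le !leNgt; apply/andP; split; apply/negP => ll.
- have /lc : l' \in `]0, l[ by rewrite in_itv/= l'0 ll.
  by rewrite in_itv/= addr0 ltxx andbF.
- have /l'c : l \in `]0, l'[ by rewrite in_itv/= l0 ll.
  by rewrite in_itv/= subr0 ltxx andbF.
Qed.

(** After a reflection of the target the images of [l / 3] and [l / 3 * 2] are in order. Distances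
    to these two points determine [f] as a translation, and mapping one interval onto the other
    forces the shift to be 0. *)
Lemma isometry_itv (R : realFieldType) (l l' : R) (f : R -> R) : 0 < l -> 0 < l' ->
  (forall s, s \in `]0, l[ -> f s \in `]0, l'[) ->
  (forall t, t \in `]0, l'[ -> exists2 s, s \in `]0, l[ & f s = t) ->
  (forall s t, s \in `]0, l[ -> t \in `]0, l[ -> `|f s - f t| = `|s - t|) ->
  l = l' /\ ((forall s, s \in `]0, l[ -> f s = s) \/
             (forall s, s \in `]0, l[ -> f s = l - s)).
Proof.
move=> l0 l'0; wlog : f / f (l / 3) <= f (l / 3 * 2).
  move=> H fl fs fD.
  have [/H|/ltW ab] := leP (f (l / 3)) (f (l / 3 * 2)); first exact.
  have [|s|t t0|s t s0 t0|ll' [fE|fE]] := H (fun s => l' - f s).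
  - by rewrite lerD2l lerN2.
  - by move=> /fl; rewrite !in_itv/= => /andP[? ?]; apply/andP; split; lra.
  - have /fs[s sl fst] : l' - t \in `]0, l'[.
      by move: t0; rewrite !in_itv/= => /andP[? ?]; apply/andP; split; lra.
    by exists s => //; rewrite fst subKr.
  - by rewrite -fD// distrC; congr `|_|; ring.
  - by split=> //; right => s /fE; lra.
  - by split=> //; left => s /fE; lra.
move=> ab fl fs fD.
have al : l / 3 \in `]0, l[ by rewrite in_itv/=; apply/andP; split; lra.
have bl : l / 3 * 2 \in `]0, l[ by rewrite in_itv/=; apply/andP; split; lra.
have fab : f (l / 3 * 2) - f (l / 3) = l / 3.
  rewrite -[LHS]ger0_norm ?subr_ge0// fD// ger0_norm; last lra.
  lra.
pose c := f (l / 3) - l / 3.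
have fE s : s \in `]0, l[ -> f s = s + c.
  move=> sl; suff : f s - f (l / 3) = s - l / 3 by rewrite /c; lra.
  apply: (@eqr_two_dist _ _ _ (l / 3)); [by rewrite divr_gt0|exact: fD|].
  have -> : f s - f (l / 3) - l / 3 = f s - f (l / 3 * 2) by lra.
  by rewrite fD//; congr `|_|; lra.
have [c0 ll'] : c = 0 /\ l = l'.
  apply: itv_translation => //; first by move=> s sl; rewrite -fE//; exact: fl.
  by move=> t /fs[s sl <-]; rewrite fE// addrK.
by split=> //; left => s /fE ->; rewrite c0 addr0.
Qed.

(** * The two oriented edges above an edge *)

Section EdgeParametrizations.
Context {R : realType} {T : pmetricType R} {V : set T}.
Implicit Types (x : T) (C : set T) (e : oriented_edge V).

Lemma epar_eq_interior e e' : elen e = elen e' ->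
  {in `]0, elen e[, epar e =1 epar e'} -> e = e'.
Proof.
move=> ll ee; apply: oriented_edge_ext => //; apply/funext => t.
rewrite -epar_clamp -(epar_clamp e') -ll.
have := clamp_in t (ltW (elen_gt0 e)); move: (clamp _ t) => {}t tl.
apply/mdist_positivity/eqP; rewrite eq_le mdist_ge0 andbT.
apply/ler_addgt0Pr => h h0; rewrite add0r.
have h2 : 0 < h / 2 by rewrite divr_gt0.
have [s sl st] := itv_approx (elen_gt0 e) h2 tl.
apply: le_trans (metric_triangle _ (epar e s) _) _.
rewrite (splitr h) lerD//.
  by apply: le_trans (epar_lipschitz _ _ _) _; exact: ltW.
rewrite ee//; apply: le_trans (epar_lipschitz _ _ _) _.
by rewrite distrC ltW.
Qed.

(** Both parametrizations measure the same path distance, so the change of parameter is an isometry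
    of intervals, that is the identity or the reversal. *)
Lemma edge_set_eq e e' : edge_set e = edge_set e' -> e' = e \/ e' = ebar e.
Proof.
move=> ee'; have [l0 l'0] := (elen_gt0 e, elen_gt0 e').
have : forall s, exists t, s \in `]0, elen e[ ->
    (t \in `]0, elen e'[) /\ epar e' t = epar e s.
  move=> s; have [sl|sl] := pselect (s \in `]0, elen e[); last by exists 0.
  by have := epar_edge_set sl; rewrite ee' => -[t tl et]; exists t.
move=> /choice[f fP].
have [_ _ eD] := epar_unit e; have [_ _ e'D] := epar_unit e'.
have [ll fE] : elen e = elen e' /\ ((forall s, s \in `]0, elen e[ -> f s = s) \/
    (forall s, s \in `]0, elen e[ -> f s = elen e - s)).
  apply: isometry_itv => //.
  - by move=> s /fP[].
  - move=> t tl; have := epar_edge_set tl; rewrite -ee' => -[s sl es].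
    exists s => //; have [fl fs] := fP s sl.
    by apply: epar_inj fl tl _; rewrite fs es.
  - move=> s t sl tl; have [fs es] := fP s sl; have [ft et] := fP t tl.
    apply: EFin_inj; rewrite -(e'D _ _ fs ft) -(eD _ _ sl tl) es et.
    by move: ee'; rewrite /edge_set => ->.
case: fE => fE; [left|right]; apply: epar_eq_interior => //=.
- by rewrite -ll => s sl; have [_ <-] := fP s sl; rewrite fE.
- rewrite -ll => s sl; rewrite /rpar.
  have sl' : elen e - s \in `]0, elen e[.
    by move: sl; rewrite !in_itv/= subr_gt0 gtrBl => /andP[-> ->].
  by have [_ <-] := fP _ sl'; rewrite fE// subKr.
Qed.

Lemma ebar_neq e : ebar e <> e.
Proof.
move=> /(congr1 (@epar _ _ _)) /= ee; have l0 := elen_gt0 e.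
have sl : elen e / 3 \in `]0, elen e[ by rewrite in_itv/=; apply/andP; split; lra.
have sl' : elen e - elen e / 3 \in `]0, elen e[.
  by rewrite in_itv/=; apply/andP; split; lra.
have /(epar_inj sl' sl) : epar e (elen e - elen e / 3) = epar e (elen e / 3).
  by rewrite -[in RHS]ee.
by lra.
Qed.

(** The choice made by [xget] depends only on the pair of directions, which is the same set for [e]
    and [ebar e]; hence exactly one of the two is selected. *)
Lemma orientation_exists : oriented_edge V -> exists O : set (oriented_edge V), orientation O.
Proof.
move=> e0; pose O e := xget e0 [set e' | e' = e \/ e' = ebar e] = e.
exists O => e; rewrite /O ebarK.
rewrite (_ : [set e' | e' = ebar e \/ e' = e] = [set e' | e' = e \/ e' = ebar e]); last first.
  by apply/seteqP; split=> e' /= [->|->]; tauto.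
have : (xget e0 [set e' | e' = e \/ e' = ebar e] = e \/
    xget e0 [set e' | e' = e \/ e' = ebar e] = ebar e).
  by apply: (@xgetPex _ e0 [set e' | e' = e \/ e' = ebar e]); exists e; left.
by move: (xget _ _) => y [->|->]; split=> // /esym; have := @ebar_neq e.
Qed.

Lemma unit_param_rev C (l : R) (g : R -> T) : unit_param C l g ->
  unit_param C l (fun t => g (l - t)).
Proof.
have in_l t : t \in `]0, l[ -> l - t \in `]0, l[.
  by rewrite !in_itv/= subr_gt0 gtrBl => /andP[-> ->].
move=> [l0 gimg gD]; split=> //.
  rewrite -gimg; apply/seteqP; split=> _ [t tl <-]; first by exists (l - t) => //; exact: in_l.
  by exists (l - t); [exact: in_l|rewrite subKr].
move=> s t sl tl; rewrite gD ?in_l//; congr (_%:E).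
by rewrite opprB addrC addrA subrK distrC.
Qed.

(** The end that the open interval lacks: [p] is a cluster point of [g] at 0 from the right,
    provided by compactness. *)
Lemma unit_param_end C (l : R) (g : R -> T) : compact [set: T] -> unit_param C l g ->
  exists p, forall t, t \in `]0, l[ -> mdist p (g t) <= t.
Proof.
move=> Tc gC; have [l0 _ _] := gC.
have [p [_ pcl]] := Tc (g @ (0 : R)^'+) _ filterT.
exists p => t tl; apply/ler_addgt0Pr => h h0.
have h2 : 0 < h / 2 by rewrite divr_gt0.
pose h' := Num.min (h / 2) l.
have h'0 : 0 < h' by rewrite lt_min h2.
have : (g @ (0 : R)^'+) (g @` [set s | 0 < s < h']).
  have : \forall s \near (0 : R)^'+, 0 < s < h'.
    near=> s; apply/andP; split; near: s; first exact: nbhs_right_gt.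
    exact: nbhs_right_lt.
  by apply: filterS => s sh; exists s.
have : nbhs p [set y | mdist p y < h / 2] by apply/nbhs_distP; exists (h / 2).
move=> pN gN; have [_ [[s /andP[s0 sh] <-] ps]] := pcl _ _ gN pN.
have sl : s \in `]0, l[ by rewrite in_itv/= s0 (lt_le_trans sh)// ge_min lexx orbT.
apply: le_trans (metric_triangle _ (g s) _) _.
have := unit_param_lipschitz gC sl tl.
have {}sh : s < h / 2 by rewrite (lt_le_trans sh)// ge_min lexx.
have : `|s - t| <= s + t.
  by move: tl; rewrite in_itv/= => /andP[t0 _]; rewrite ler_norml; apply/andP; split; lra.
by move: ps; rewrite /=; move: (mdist _ _) (mdist _ _) `|_| => a b c; lra.
Unshelve. all: by end_near. Qed.

(** [vertex_set] parametrizes only the open edge, whereas [oriented_edge] asks for a continuous map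
    on the whole line. The ends come from [unit_param_end], and the map is made constant beyond
    them. *)
Lemma edge_parametrized C : compact [set: T] -> vertex_set V -> edges V C ->
  exists e, edge_set e = C.
Proof.
move=> Tc [_ _ VC] EC; have [l [g gC]] := VC _ EC.
have [l0 gimg gD] := gC.
have [p pP] := unit_param_end Tc gC.
have [p' p'P] := unit_param_end Tc (unit_param_rev gC).
pose h t := if t <= 0 then p else if l <= t then p' else g t.
have hg t : t \in `]0, l[ -> h t = g t.
  by rewrite in_itv/= /h !leNgt => /andP[-> ->].
have himg : h @` `]0, l[ = C.
  by rewrite -gimg; apply/seteqP; split=> _ [t tl <-]; exists t => //; rewrite hg.
have h_unit : unit_param C l h by split=> // s t sl tl; rewrite !hg// gD.
have pp' : mdist p p' <= l.
  have l2 : l / 2 \in `]0, l[ by rewrite in_itv/=; apply/andP; split; lra.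
  apply: le_trans (metric_triangle _ (g (l / 2)) _) _.
  have := pP _ l2; have := p'P _ l2; rewrite (metric_sym p').
  have -> : l - l / 2 = l / 2 by lra.
  by move: (mdist _ _) (mdist _ _) => *; lra.
have h_lip s t : mdist (h s) (h t) <= `|s - t|.
  wlog st : s t / s <= t.
    by move=> H; have [/H//|/ltW/H] := leP s t; rewrite metric_sym distrC.
  rewrite (distrC s) (ger0_norm (_ : 0 <= t - s)) ?subr_ge0//.
  rewrite /h; have [s0|s0] := leP s 0; have [t0|t0] := leP t 0.
  - by rewrite mdistxx subr_ge0.
  - have [lt|tl] := leP l t; first by move: pp'; lra.
    have := pP t; rewrite in_itv/= t0 tl => /(_ isT).
    by move: (mdist _ _) => *; lra.
  - by lra.
  - have [ls|sl] := leP l s; have [lt|tl] := leP l t.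
    + by rewrite mdistxx subr_ge0.
    + by lra.
    + have := p'P (l - s); rewrite in_itv/= subKr (metric_sym p') subr_gt0 gtrBl s0 sl => /(_ isT).
      by move: (mdist _ _) => *; lra.
    + have := @unit_param_lipschitz _ _ C l g s t gC.
      rewrite !in_itv/= s0 t0 sl tl => /(_ isT isT).
      by rewrite (distrC s) (ger0_norm (_ : 0 <= t - s)) ?subr_ge0.
have h_edge : edges V (h @` `]0, l[) by rewrite himg.
have h_unit' : unit_param (h @` `]0, l[) l h by rewrite himg.
have h_left t : t <= 0 -> h t = h 0 by move=> t0; rewrite /h t0 lexx.
have h_right t : l <= t -> h t = h l.
  by move=> lt; rewrite /h !leNgt l0 (lt_le_trans l0 lt) -!leNgt lt lexx.
exists (OrientedEdge h_edge h_unit' (lipschitz_continuous h_lip) h_left h_right).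
exact: himg.
Qed.

End EdgeParametrizations.

(** * Lifting edges through the covering *)

Lemma glue_lipschitz (R : realType) (T : metricType R) (F G : R -> T) (b : R) :
  (forall s t, mdist (F s) (F t) <= `|s - t|) ->
  (forall s t, mdist (G s) (G t) <= `|s - t|) -> F b = G b ->
  let H t := if t <= b then F t else G t in
  forall s t, mdist (H s) (H t) <= `|s - t|.
Proof.
move=> Fl Gl FG H s t; wlog st : s t / s <= t.
  by move=> W; have [/W//|/ltW/W] := leP s t; rewrite metric_sym distrC.
rewrite /H; have [sb|bs] := leP s b; have [tb|bt] := leP t b => //.
- apply: le_trans (metric_triangle _ (F b) _) _; rewrite {2}FG.
  apply: le_trans (lerD (Fl s b) (Gl b t)) _.
  rewrite (distrC s b) (distrC b t) (distrC s t) !ger0_norm ?subr_ge0 ?(ltW bt)//.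
  by lra.
- by lra.
Qed.

Section Lifting.
Context {R : realType} {T' T : pmetricType R} {phi : T' -> T}.
Hypothesis T_compact : compact [set: T].
Hypothesis phi_iso : isometric_on_sheets phi.

(** [d] is a Lebesgue number for the evenly covered sets of the base, hence independent of [x']; [s]
    inverts [phi] on the sheet [W] through [x']. *)
Lemma local_section : exists2 d : R, 0 < d & forall x', exists W (s : T -> T'),
  [/\ open W, W x', forall y, mdist (phi x') y < d -> W (s y) /\ phi (s y) = y
    & forall y z, W y -> W z -> mdist (phi y) (phi z) = mdist y z].
Proof.
pose P (A : set T) := exists U S, [/\ A `<=` U, sheets phi U S
  & forall W, S W -> {in W &, forall y z, mdist (phi y) (phi z) = mdist y z}].
have [|x _|d d0 dP] := @lebesgue_number _ _ [set: T] P T_compact.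
- by move=> A B AB [U [S [BU US iso]]]; exists U, S; split=> //; exact: subset_trans BU.
- have [U [S [Ux US iso]]] := phi_iso x; have [Uo _ _ _] := US.
  exists U; last by exists U, S; split.
  by apply: open_nbhs_nbhs; split.
exists d => // x'; have [U [S [dU US iso]]] := dP (phi x') I.
have [Uo Scov _ SW] := US.
have : (phi @^-1` U) x' by apply: dU; rewrite ballEmdist/= mdistxx.
rewrite -Scov => -[W WS Wx']; have [Wo [Wfun Winj Wsurj] _] := SW _ WS.
exists W, (fun y => xget x' [set w | W w /\ phi w = y]); split=> //.
- move=> y yd; apply: (@xgetPex _ x' [set w | W w /\ phi w = y]).
  have /Wsurj[w Ww wy] : U y by apply: dU; rewrite ballEmdist.
  by exists w.
- by move=> y z Wy Wz; apply: iso WS _ _ _ _; exact: mem_set.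
Qed.

Lemma sheet_inj (W : set T') :
  (forall y z, W y -> W z -> mdist (phi y) (phi z) = mdist y z) ->
  forall y z, W y -> W z -> phi y = phi z -> y = z.
Proof.
by move=> iso y z Wy Wz yz; apply: mdist_positivity; rewrite -iso// yz mdistxx.
Qed.

Lemma path_lift (h : R -> T) (l : R) x' : 0 <= l ->
  (forall s t, mdist (h s) (h t) <= `|s - t|) -> phi x' = h 0 ->
  exists F : R -> T', [/\ F 0 = x', forall s t, mdist (F s) (F t) <= `|s - t|
    & forall t, phi (F t) = h (clamp l t)].
Proof.
move=> l0 hl x'h; (* The uniform radius d of the sections allows steps of length d / 2. *)
have [d d0 sec] := local_section.
have d2 : 0 < d / 2 by rewrite divr_gt0.
(* Induction on the number of steps; [Num.bound] supplies enough of them to pass [l]. *)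
have [F [F0 Fl phiF]] : exists F : R -> T', [/\ F 0 = x',
    forall s t, mdist (F s) (F t) <= `|s - t|
    & forall t, phi (F t) = h (clamp ((Num.bound (l / (d / 2)))%:R * (d / 2)) t)].
  elim: (Num.bound _) => [|n [F [F0 Fl phiF]]].
    exists (fun=> x'); split=> // [s t|t]; first by rewrite mdistxx.
    rewrite mul0r x'h; congr (h _); apply/eqP.
    by rewrite eq_le; exact: (clamp_in t (lexx 0)).
  set b := _ * _ in phiF.
  have b0 : 0 <= b by rewrite mulr_ge0 ?ler0n// ltW.
  have -> : n.+1%:R * (d / 2) = b + d / 2 by rewrite -natr1 mulrDl mul1r.
  have [W [s [Wo WF sP iso]]] := sec (F b).
  have Fb : phi (F b) = h b by rewrite phiF clamp_id ?b0/=.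
  (* [c] retracts the line onto the segment from [b] to [b + d / 2], where [h] stays within [d] of
     [h b], so that the section lifts the whole step. *)
  pose c t := clamp (b + d / 2) (Num.max b t).
  have bc t : b <= c t <= b + d / 2.
    have bd : b <= b + d / 2 by lra.
    by rewrite /c /clamp !le_max le_min !le_max !lexx bd ge_max ge_min lexx !orbT
      (le_trans b0 bd).
  have cb t : mdist (phi (F b)) (h (c t)) < d.
    rewrite Fb; apply: le_lt_trans (hl _ _) _.
    by have /andP[? ?] := bc t; rewrite ltr_norml; apply/andP; split; lra.
  have cl t t' : `|c t - c t'| <= `|t - t'|.
    apply: le_trans (clamp_lipschitz _ _ _) _.
    rewrite /Num.max; case: ltP => ?; case: ltP => ? //; rewrite ?subrr ?normr0//.
      by rewrite !ger0_norm; lra.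
    by rewrite !ler0_norm; lra.
  exists (fun t => if t <= b then F t else s (h (c t))); split.
  - by rewrite b0.
  - apply: glue_lipschitz => // [t t'|].
      have [[Wt phit] [Wt' phit']] := (sP _ (cb t), sP _ (cb t')).
      by rewrite -iso// phit phit' (le_trans (hl _ _)).
    have [Wb phib] := sP _ (cb b).
    apply: (sheet_inj iso) => //; rewrite phib Fb /c max_l// clamp_id//.
    by rewrite b0/=; lra.
  - move=> t; have [tb|bt] := leP t b.
      rewrite phiF /clamp !min_l//; lra.
    have [_ ->] := sP _ (cb t).
    by rewrite /c max_r// ltW.
exists (F \o clamp l); split=> [|s t|t] /=.
- by rewrite clamp_id ?lexx.
- exact: le_trans (Fl _ _) (clamp_lipschitz _ _ _).
- rewrite phiF clamp_id//; have /andP[-> tl] := clamp_in t l0.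
  apply: le_trans tl _; rewrite -ler_pdivrMr//.
  apply: ltW; apply: archi_boundP.
  by rewrite divr_ge0// ltW.
Qed.

Lemma lift_unique (F G : R -> T') t0 : continuous F -> continuous G ->
  (forall t, phi (F t) = phi (G t)) -> F t0 = G t0 -> F = G.
Proof.
move=> Fc Gc FG FGt0; pose A : set R := [set t | F t = G t].
suff AT : A = [set: R].
  by apply/funext => t; have : A t by rewrite AT.
have [d d0 sec] := local_section.
have oA : open A.
  rewrite openE => t At; have [W [s [Wo WF _ iso]]] := sec (F t).
  have FW : nbhs t (F @^-1` W) by apply: Fc; exact: open_nbhs_nbhs.
  have GW : nbhs t (G @^-1` W) by apply: Gc; rewrite -[G t]At; exact: open_nbhs_nbhs.
  by apply: filterS2 FW GW => u FWu GWu; exact: (sheet_inj iso).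
have cA : closed A.
  rewrite -[A]setCK; apply: open_closedC; rewrite openE => t nAt.
  have m0 : 0 < mdist (F t) (G t) by rewrite mdist_gt0; exact/eqP.
  have m2 : 0 < mdist (F t) (G t) / 2 by rewrite divr_gt0.
  have FN : nbhs t (F @^-1` [set y | mdist (F t) y < mdist (F t) (G t) / 2]).
    by apply: Fc; apply/nbhs_distP; exists (mdist (F t) (G t) / 2).
  have GN : nbhs t (G @^-1` [set y | mdist (G t) y < mdist (F t) (G t) / 2]).
    by apply: Gc; apply/nbhs_distP; exists (mdist (F t) (G t) / 2).
  apply: filterS2 FN GN => u /= Fu Gu Au.
  have := metric_triangle (F t) (F u) (G t).
  rewrite [in mdist (F u) _]Au (metric_sym (G u)).
  move=> {Au FG FGt0}; move: Fu Gu.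
  by move: (mdist _ _) (mdist _ _) (mdist _ _) => *; lra.
have cR : connected [set: R].
  by apply/connected_intervalP => x y _ _ z _.
by apply: cR; [exists t0|exists A => //; rewrite setTI|exists A => //; rewrite setTI].
Qed.

End Lifting.

Lemma connected_clopen (T : topologicalType) (A B : set T) : connected A ->
  B `<=` A -> B !=set0 -> open B -> (exists2 C, closed C & B = A `&` C) -> B = A.
Proof.
move=> Ac BA B0 Bo Bc; apply: Ac => //; exists B => //.
by rewrite setIC; apply/esym/setIidPl.
Qed.

Section LiftedEdges.
Context {R : realType} {T' T : pmetricType R} {phi : T' -> T} {V : set T}.
Hypothesis T_graph : metric_graph T.
Hypothesis T_compact : compact [set: T].
Hypothesis V_vertex : vertex_set V.
Hypothesis phi_iso : isometric_on_sheets phi.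
Hypothesis phi_continuous : continuous phi.
Local Notation V' := (phi @^-1` V).
Implicit Types (e : oriented_edge V).

Section OneLift.
Variables (e : oriented_edge V) (G : R -> T').
Hypothesis G_lip : forall s t, mdist (G s) (G t) <= `|s - t|.
Hypothesis phiG : forall t, phi (G t) = epar e t.
Local Notation l := (elen e).
Local Notation C' := (G @` `]0, l[).

Let G_continuous : continuous G.
Proof. exact: lipschitz_continuous. Qed.

Lemma lift_inj s t : s \in `]0, l[ -> t \in `]0, l[ -> G s = G t -> s = t.
Proof. by move=> sl tl st; apply: epar_inj sl tl _; rewrite -!phiG st. Qed.

Lemma lift_local t : t \in `]0, l[ -> exists d : R, [/\ 0 < d,
    forall s, `|s - t| < d -> s \in `]0, l[,
    forall s s', `|s - t| < d -> `|s' - t| < d -> mdist (G s) (G s') = `|s - s'|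
  & nbhs (G t) (G @` [set s | `|s - t| < d])].
Proof.
move=> tl; have [h [h0 hl hD hN]] := unit_param_local T_graph V_vertex
  (fun x => @edge_notin _ _ _ _ x (epar_edge e)) (epar_unit e) tl.
have [r r0 sec] := local_section T_compact phi_iso.
have [W [_ [Wo WG _ iso]]] := sec (G t).
have /nbhs_ballP[u u0 uW] : nbhs t (G @^-1` W).
  by apply: G_continuous; exact: open_nbhs_nbhs.
pose d := Num.min h u.
have d0 : 0 < d by rewrite lt_min h0.
have dW s : `|s - t| < d -> W (G s).
  move=> sd; apply: uW; rewrite /ball/= distrC (lt_le_trans sd)//.
  by rewrite ge_min lexx orbT.
have dh s : `|s - t| < d -> `|s - t| < h.
  by move=> sd; rewrite (lt_le_trans sd)// ge_min lexx.
exists d; split=> //; first by move=> s /dh; exact: hl.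
  move=> s s' sd s'd; rewrite -iso; [|exact: dW|exact: dW].
  by rewrite !phiG hD//; exact: dh.
have dN := hN _ d0; rewrite ge_min lexx in dN; have {}dN := dN isT.
rewrite -phiG in dN.
have WN : nbhs (G t) W by exact: open_nbhs_nbhs.
apply: filterS2 WN (phi_continuous dN) => y Wy [s sd sy].
exists s => //; apply: (sheet_inj iso) => //; first exact: dW.
by rewrite phiG.
Qed.

Lemma lift_notin t : t \in `]0, l[ -> ~ V' (G t).
Proof. by move=> tl; rewrite /= phiG; exact: epar_notin. Qed.

(** [C'] is connected and avoids the preimage of [V]. It is open by [lift_local], and closed in that
    complement because adding the two ends, which lie over vertices, makes it compact. So it is a
    whole component. *)
Lemma lift_edges : edges V' C'.
Proof.
have l0 := elen_gt0 e.
have l2 : l / 2 \in `]0, l[ by rewrite in_itv/=; apply/andP; split; lra.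
exists (G (l / 2)); first exact: lift_notin.
have C'D : C' `<=` connected_component (~` V') (G (l / 2)).
  apply: connected_component_max; first by exists (l / 2).
    by move=> _ [t tl <-]; exact: lift_notin.
  apply: connected_continuous_connected; last exact: continuous_subspaceT.
  by apply/connected_intervalP; exact: interval_is_interval.
apply: connected_clopen => //.
- exact: component_connected.
- by exists (G (l / 2)), (l / 2).
- rewrite openE => _ [t tl <-]; have [d [d0 dl _ dN]] := lift_local tl.
  by apply: filterS dN => _ [s /dl sl <-]; exists s.
- exists (G @` `[0, l]).
    apply: compact_closed; first exact: metric_hausdorff.
    apply: continuous_compact; last exact: segment_compact.
    exact: continuous_subspaceT.
  apply/seteqP; split=> [y Cy|y [Dy [t tl ty]]].
    split; first exact: C'D.
    move: Cy => [t tl <-]; exists t => //.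
    by move: tl; rewrite /= !in_itv/= => /andP[/ltW -> /ltW ->].
  move: Dy; rewrite -ty => /connected_component_sub/= nVt.
  exists t => //; move: tl; rewrite /= !in_itv/= !le_eqVlt.
  move=> /andP[/orP[/eqP t0|->] /orP[/eqP tl|->]] //; exfalso; apply: nVt.
  + by rewrite -t0 phiG; exact: eminus_vertex.
  + by rewrite -t0 phiG; exact: eminus_vertex.
  + by rewrite tl phiG; exact: eplus_vertex.
Qed.

Lemma lift_unit : unit_param C' l G.
Proof.
split=> //; first exact: elen_gt0.
move=> s t sl tl; apply/eqP; rewrite eq_le; apply/andP; split.
  pose p a := G (s + a * (t - s)).
  have -> : G s = p 0 by rewrite /p mul0r addr0.
  have -> : G t = p 1 by rewrite /p mul1r addrC subrK.
  apply: path_dist_lipschitz => //.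
    move=> a b _ _; apply: le_trans (G_lip _ _) _.
    by rewrite opprD addrACA subrr add0r -mulrBl normrM mulrC (distrC t).
  move=> _ [a a01 <-]; exists (s + a * (t - s)) => //.
  move: sl tl a01; rewrite /= !in_itv/= => /andP[? ?] /andP[? ?] /andP[a0 a1].
  have := segment_between s t a0 a1; rewrite ge_min le_max.
  move=> /andP[/orP[?|?] /orP[?|?]]; apply/andP; split; lra.
apply: le_ereal_inf_tmp => _ [g [gc g0 g1 gC] <-].
have : forall a, exists u, a \in `[0, 1] -> (u \in `]0, l[) /\ G u = g a.
  move=> a; have [a01|na] := pselect (a \in `[0, 1]); last by exists 0.
  have [u ul gu] : C' (g a) by apply: gC; exists a.
  by exists u.
(* The parameter u along a path g in C' varies at most as fast as g, because
   G is a local isometry. *)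
move=> /choice[u uP].
have in0 : (0 : R) \in `[0, 1] by rewrite in_itv/= lexx ler01.
have in1 : (1 : R) \in `[0, 1] by rewrite in_itv/= lexx ler01.
have u0 : u 0 = s by have [ul ug] := uP _ in0; apply: lift_inj => //; rewrite ug.
have u1 : u 1 = t by have [ul ug] := uP _ in1; apply: lift_inj => //; rewrite ug.
rewrite -u0 -u1 distrC; apply: path_length_ge_height.
pose P (A : set R) := forall a b, A a -> A b -> a \in `[0, 1] -> b \in `[0, 1] ->
  `|u a - u b| <= mdist (g a) (g b).
have [|a a01|d d0 dP] := @lebesgue_number R R `[0, 1] P (@segment_compact _ 0 1).
- by move=> A B AB PB a b Aa Ab; apply: PB; exact: AB.
- have [ul ug] := uP _ a01; have [d [d0 dl dD]] := lift_local ul.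
  rewrite ug => /nbhs_distP[h h0 hN].
  have [r r0 rP] := (within_distP _ _).1 gc a a01 h h0.
  exists (ball a r); first exact: nbhsx_ballx.
  have near_u b : ball a r b -> b \in `[0, 1] -> `|u b - u a| < d.
    move=> ab b01; have [v vd gv] := hN _ (rP _ b01 ab).
    have [ubl ub] := uP _ b01; suff -> : u b = v by [].
    by apply: lift_inj; [|exact: dl|rewrite ub].
  move=> b c ab ac b01 c01; have [_ <-] := uP _ b01; have [_ <-] := uP _ c01.
  by rewrite dD//; exact: near_u.
exists d => // a b a01 b01 ab; apply: (dP a a01) => //; first exact: ballxx.
Qed.

End OneLift.

(** [x'] may lie over any position [t], ends included, so the edge is lifted from [t] in both
    directions and the two lifts are glued there. *)
Lemma lift_oriented_edge e t x' : t \in `[0, elen e] -> phi x' = epar e t ->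
  exists e' : oriented_edge V', [/\ elen e' = elen e,
    forall s, phi (epar e' s) = epar e s & epar e' t = x'].
Proof.
rewrite in_itv/= => /andP[t0 tl] x't; have l0 := elen_gt0 e.
have [F1 [F10 F1l phiF1]] : exists F : R -> T', [/\ F 0 = x',
    forall s s', mdist (F s) (F s') <= `|s - s'|
    & forall s, phi (F s) = epar e (t + clamp (elen e) s)].
  apply: (@path_lift _ _ _ _ T_compact phi_iso (fun s => epar e (t + s))).
  - exact: ltW.
  - move=> s s'; apply: le_trans (epar_lipschitz _ _ _) _.
    by rewrite opprD addrACA subrr add0r.
  - by rewrite addr0.
have [F2 [F20 F2l phiF2]] : exists F : R -> T', [/\ F 0 = x',
    forall s s', mdist (F s) (F s') <= `|s - s'|
    & forall s, phi (F s) = epar e (t - clamp (elen e) s)].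
  apply: (@path_lift _ _ _ _ T_compact phi_iso (fun s => epar e (t - s))).
  - exact: ltW.
  - move=> s s'; apply: le_trans (epar_lipschitz _ _ _) _.
    by rewrite opprD opprK addrACA subrr add0r addrC distrC.
  - by rewrite subr0.
pose H s := if s <= t then F2 (t - s) else F1 (s - t).
have Hl : forall s s', mdist (H s) (H s') <= `|s - s'|.
  apply: (@glue_lipschitz _ _ (fun s => F2 (t - s)) (fun s => F1 (s - t))).
  - move=> s s'; apply: le_trans (F2l _ _) _.
    by rewrite opprD opprK addrACA subrr add0r addrC distrC.
  - move=> s s'; apply: le_trans (F1l _ _) _.
    by rewrite opprB addrA subrK.
  - by rewrite subrr F10 F20.
pose G s := H (clamp (elen e) s).
have Gl s s' : mdist (G s) (G s') <= `|s - s'|.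
  exact: le_trans (Hl _ _) (clamp_lipschitz _ _ _).
have phiG s : phi (G s) = epar e s.
  rewrite -(epar_clamp e s) /G; have := clamp_in s (ltW l0).
  move: (clamp _ s) => {}s /andP[s0 sl]; rewrite /H; case: leP => st.
    by rewrite phiF2 clamp_id ?subKr// subr_ge0 st/=; lra.
  rewrite phiF1 clamp_id; first by rewrite addrC subrK.
  by rewrite subr_ge0 ltW//=; lra.
have clamp0 s : s <= 0 -> clamp (elen e) s = 0.
  by move=> s0; rewrite /clamp min_l ?(le_trans s0 (ltW l0))// max_l.
have clampl s : elen e <= s -> clamp (elen e) s = elen e.
  by move=> ls; rewrite /clamp min_r// max_r// ltW.
have G_left s : s <= 0 -> G s = G 0 by move=> s0; rewrite /G !clamp0.
have G_right s : elen e <= s -> G s = G (elen e) by move=> ls; rewrite /G !clampl.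
exists (OrientedEdge (lift_edges Gl phiG) (lift_unit Gl phiG)
  (lipschitz_continuous Gl) G_left G_right); split=> //=.
by rewrite /G clamp_id ?t0// /H lexx subrr.
Qed.

End LiftedEdges.

(** * The model of the cover above [V] *)

Section LiftedModel.
Context {R : realType} {T' T : pmetricType R} {phi : T' -> T} {V : set T}.
Hypothesis T_graph : metric_graph T.
Hypothesis T_compact : compact [set: T].
Hypothesis V_vertex : vertex_set V.
Hypothesis phi_iso : isometric_on_sheets phi.
Hypothesis phi_continuous : continuous phi.
Local Notation V' := (phi @^-1` V).
Implicit Types (e : oriented_edge V) (f : oriented_edge V').

(** Through a point [x'] of [C'] passes a lift of the edge containing [phi x']; it and [C'] are
    components of the same set that share a point. *)
Lemma edge_lift C' : edges V' C' -> exists e f, [/\ edge_set f = C',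
  elen f = elen e & forall s, phi (epar f s) = epar e s].
Proof.
move=> VC'; have [x' nV' C'x] := VC'.
have VC : edges V (connected_component (~` V) (phi x')) by exact: component_edge.
have [e eC] := edge_parametrized T_compact V_vertex VC.
have : edge_set e (phi x') by rewrite eC; exact: connected_component_refl.
move=> [t tl et].
have tl' : t \in `[0, elen e].
  by move: tl; rewrite /= !in_itv/= => /andP[/ltW -> /ltW ->].
have [f [le phie ft]] := lift_oriented_edge T_graph T_compact V_vertex phi_iso
  phi_continuous tl' (esym et).
exists e, f; split=> //.
apply: (@edges_eq _ _ V' _ _ x') => //; first exact: epar_edge.
  by rewrite -ft; apply: epar_edge_set; rewrite le.
by rewrite C'x; exact: connected_component_refl.
Qed.

Lemma edge_push f : exists e, elen e = elen f /\
  forall s, phi (epar f s) = epar e s.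
Proof.
have [e0 [f0 [e0C le phie]]] := edge_lift (epar_edge f).
have [->|->] := edge_set_eq e0C; first by exists e0.
exists (ebar e0); split=> // s /=.
by rewrite /rpar phie le.
Qed.

Lemma covering_nbhs x' (N : set T') : nbhs x' N -> nbhs (phi x') (phi @` N).
Proof.
have [d d0 sec] := local_section T_compact phi_iso.
have [W [s [Wo Wx sP iso]]] := sec x'.
move=> /nbhs_distP[h h0 hN]; apply/nbhs_distP; exists (Num.min d h).
  by rewrite lt_min d0.
move=> y; rewrite lt_min => /andP[yd yh]; have [Ws phis] := sP y yd.
exists (s y) => //; apply: hN; rewrite -iso// phis//.
Qed.

(** The star is shrunk to fit in a sheet, where [phi] is an isometry. Points of valence other than 2
    in the cover therefore lie over [V]. *)
Lemma has_valence_push x' n : has_valence x' n -> has_valence (phi x') n.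
Proof.
move=> [r r0 [sigma [sigma0 sigmaD sigmaN]]].
have [d d0 sec] := local_section T_compact phi_iso.
have [W [_ [Wo Wx _ iso]]] := sec x'.
have /nbhs_distP[h h0 hW] : nbhs x' W by exact: open_nbhs_nbhs.
pose r' := Num.min r h.
have r'0 : 0 < r' by rewrite lt_min r0.
have r'r s : s \in `[0, r'[ -> s \in `[0, r[.
  by rewrite !in_itv/= lt_min => /and3P[-> -> _].
have z_in : (0 : R) \in `[0, r[ by rewrite in_itv/= lexx.
have dist0 i s : s \in `[0, r[ -> mdist x' (sigma i s) = s.
  move=> sr; rewrite -(sigma0 i) sigmaD// /star_dist eqxx sub0r normrN ger0_norm//.
  by move: sr; rewrite in_itv/= => /andP[].
have sW i s : s \in `[0, r'[ -> W (sigma i s).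
  move=> sr; apply: hW; rewrite dist0; last exact: r'r.
  by move: sr; rewrite in_itv/= lt_min => /and3P[].
exists r' => //; exists (fun i s => phi (sigma i s)); split.
- by move=> i; rewrite sigma0.
- move=> i j s t sr tr; rewrite iso; [|exact: sW|exact: sW].
  by rewrite sigmaD//; exact: r'r.
- have BN : nbhs x' [set y | mdist x' y < r'] by apply/nbhs_distP; exists r'.
  apply: filterS (covering_nbhs (filterI sigmaN BN)) => _ [y [[->|[i _ [s sr sy]]] yr] <-].
    by left.
  right; exists i => //; exists s; last by rewrite sy.
  move: (sr) yr; rewrite -sy /= dist0// !in_itv/= => /andP[-> _] ->//.
Qed.

Lemma lifted_vertex_set : vertex_set V'.
Proof.
have [Viso Vval _] := V_vertex; split.
- move=> v' /= Vv; have [_ [U UN UV]] := Viso _ Vv.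
  have [d d0 sec] := local_section T_compact phi_iso.
  have [W [_ [Wo Wx _ iso]]] := sec v'.
  split; first exact: mem_set.
  exists (W `&` phi @^-1` U).
    by apply: filterI; [exact: open_nbhs_nbhs|exact: phi_continuous].
  apply/seteqP; split=> [y [[Wy Uy] Vy]|_ ->].
    apply: (sheet_inj iso) => //.
    by have : (U `&` V) (phi y) by []; rewrite UV.
  by split=> //; split=> //=; have [] : (U `&` V) (phi v') by rewrite UV.
- by move=> x' n /has_valence_push; exact: Vval.
- move=> C' /edge_lift[e [f [<- le phie]]].
  by exists (elen f), (epar f); exact: epar_unit.
Qed.

Lemma lifted_elen l f : (forall e, elen e = l) -> elen f = l.
Proof. by move=> El; have [e [<- _]] := edge_push f. Qed.

(** Projection maps the edges leaving [v'] bijectively to those leaving [phi v']: onto by lifting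
    from [v'], injectively by uniqueness of lifts. *)
Lemma lifted_valence v' k : vertex_valence (V := V) (phi v') k ->
  vertex_valence (V := V') v' k.
Proof.
rewrite /vertex_valence; apply: card_eq_trans.
have /choice[push pushP] := edge_push.
have push_inj (e1 e2 : oriented_edge V') : eminus e1 = v' -> eminus e2 = v' -> push e1 = push e2 -> e1 = e2.
  move=> e1v e2v e12; have [l1 phi1] := pushP e1; have [l2 phi2] := pushP e2.
  apply: oriented_edge_ext; first by rewrite -l1 -l2 e12.
  apply: (lift_unique T_compact phi_iso (t0 := 0)).
  - exact: epar_continuous.
  - exact: epar_continuous.
  - by move=> t; rewrite phi1 phi2 e12.
  - by rewrite -[LHS]/(eminus e1) e1v -e2v.
have -> : [set e | eminus e = phi v'] = push @` [set f | eminus f = v'].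
  apply/seteqP; split=> [e ev|_ [f <- <-]]; last first.
    by have [_ phie] := pushP f; rewrite /= /eminus -phie.
  have z_in : (0 : R) \in `[0, elen e] by rewrite in_itv/= lexx ltW// elen_gt0.
  have [f [le phie ft0]] := lift_oriented_edge T_graph T_compact V_vertex phi_iso
    phi_continuous z_in (esym ev).
  exists f => //; have [l1 phi1] := pushP f.
  apply: oriented_edge_ext; first by rewrite l1.
  by apply/funext => t; rewrite -phi1 phie.
rewrite card_eq_sym; apply: inj_card_eq.
by move=> e1 e2 /set_mem e1v /set_mem e2v; exact: push_inj.
Qed.

End LiftedModel.

Lemma finite_out (R : realType) (T : pmetricType R) (V : set T) (k : nat) :
  regular_model V k -> (forall e : oriented_edge V, V (eminus e)) ->
  exists out : T -> seq (oriented_edge V),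
  [/\ forall v b, (b \in out v) = (eminus b == v), forall v, uniq (out v)
    & forall b : oriented_edge V, size (out (eminus b)) = k].
Proof.
move=> Vk eV; pose A v := [set e : oriented_edge V | eminus e = v].
have finA v : finite_set (A v).
  have [Vv|nVv] := pselect (V v); first by exists k; exact: Vk.
  rewrite (_ : A v = set0)//; apply/seteqP; split=> // e /= ev.
  by apply: nVv; rewrite -ev.
exists (fun v => finmap.enum_fset (fset_set (A v))); split.
- move=> v b; have -> : (b \in finmap.enum_fset (fset_set (A v))) = (b \in A v).
    exact: (in_fset_set (finA v)).
  apply/idP/eqP; first by move=> /set_mem.
  exact: mem_set.
- by move=> v; exact: finmap.fset_uniq.
- move=> b; have /(_ _ (eV b)) := Vk.
  exact: card_fset_set.
Qed.

(** * Edges of a simply connected graph are bridges *)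

(** For heights within 1/4 of an integer, subtracting 1 from the large ones gives representatives
    between -1/4 and 1/4, whose differences need no reduction modulo 1. *)
Lemma reduced_difference (R : realFieldType) (a b : R) :
  0 <= a < 4^-1 \/ 3 / 4 < a < 1 -> 0 <= b < 4^-1 \/ 3 / 4 < b < 1 ->
  (if `|b - a| < 2^-1 then b - a
   else if 0 < b - a then b - a - 1 else b - a + 1) =
  (if b < 2^-1 then b else b - 1) - (if a < 2^-1 then a else a - 1).
Proof.
move=> [/andP[a0 a1]|/andP[a0 a1]] [/andP[b0 b1]|/andP[b0 b1]].
- have -> : `|b - a| < 2^-1 by rewrite ltr_norml; apply/andP; split; lra.
  have -> : b < 2^-1 by lra.
  by have -> : a < 2^-1 by lra.
- have -> : (`|b - a| < 2^-1) = false.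
    by apply/negbTE; rewrite -leNgt ler_normr; apply/orP; left; lra.
  have -> : 0 < b - a by lra.
  have -> : (b < 2^-1) = false by apply/negbTE; rewrite -leNgt; lra.
  have -> : a < 2^-1 by lra.
  by ring.
- have -> : (`|b - a| < 2^-1) = false.
    by apply/negbTE; rewrite -leNgt ler_normr; apply/orP; right; lra.
  have -> : (0 < b - a) = false by apply/negbTE; rewrite -leNgt; lra.
  have -> : b < 2^-1 by lra.
  have -> : (a < 2^-1) = false by apply/negbTE; rewrite -leNgt; lra.
  by ring.
- have -> : `|b - a| < 2^-1 by rewrite ltr_norml; apply/andP; split; lra.
  have -> : (b < 2^-1) = false by apply/negbTE; rewrite -leNgt; lra.
  have -> : (a < 2^-1) = false by apply/negbTE; rewrite -leNgt; lra.
  by ring.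
Qed.

(** [h] is the height along a path that climbs the edge once and then stays off it. The reduction
    modulo 1 undoes the drop to 0, leaving the increments of a function that stops at 1. *)
Lemma wrapped_increment (R : realFieldType) (a b : R) :
  0 <= a -> a <= b -> b - a < 2^-1 ->
  let h (x : R) := if x < 1 then x else 0 in
  (if `|h b - h a| < 2^-1 then h b - h a
   else if 0 < h b - h a then h b - h a - 1 else h b - h a + 1) =
  Num.min b 1 - Num.min a 1.
Proof.
move=> a0 ab ba h; rewrite /h.
have [b1|b1] := ltP b 1; have [a1|a1] := ltP a 1.
- have -> : `|b - a| < 2^-1 by rewrite ltr_norml; apply/andP; split; lra.
  by [].
- by exfalso; lra.
- have -> : (`|0 - a| < 2^-1) = false.
    by apply/negbTE; rewrite -leNgt ler_normr; apply/orP; right; lra.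
  have -> : (0 < 0 - a) = false by apply/negbTE; rewrite -leNgt; lra.
  by ring.
- by rewrite !subrr normr0 invr_gt0 ltr0n.
Qed.

(** * Homotopy invariance of discrete sums *)

Section Homotopy.
Context {R : realType} {T : pmetricType R}.
(** A discrete closed 1-form: increments that derive locally from a potential [p]. *)
Variable theta : T -> T -> R.
Hypothesis theta_exact : forall x : T, exists2 U : set T, nbhs x U &
  exists p : T -> R, forall y z, U y -> U z -> theta y z = p z - p y.

Let thetaxx x : theta x x = 0.
Proof.
have [U Ux [p pU]] := theta_exact x.
by rewrite pU ?subrr//; exact: nbhs_singleton.
Qed.

Lemma homotopy_sum_eq0 (H : R * R -> T) (g : R -> T) :
  {within `[0, 1] `*` `[0, 1], continuous H} ->
  (forall t, t \in `[0, 1] -> H (0, t) = g t) ->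
  (forall t, t \in `[0, 1] -> H (1, t) = g 0) ->
  (forall s, s \in `[0, 1] -> H (s, 0) = g 0 /\ H (s, 1) = g 0) ->
  exists N, forall n, (N <= n)%N ->
    \sum_(0 <= i < n.+1) theta (g (i%:R / n.+1%:R)) (g (i.+1%:R / n.+1%:R)) = 0.
Proof.
(* On a fine grid the four increments around each cell cancel, so the sums along
   consecutive rows agree; the last row is constant. *)
move=> Hc H0 H1 Hs; pose Q : set (R * R) := `[0, 1] `*` `[0, 1].
pose P (A : set (R * R)) := exists p : T -> R, forall y z, A y -> A z ->
  Q y -> Q z -> theta (H y) (H z) = p (H z) - p (H y).
have Qc : compact Q by apply: compact_setX; exact: segment_compact.
have [||d d0 dP] := @lebesgue_number R _ Q P Qc.
- by move=> A B AB [p pB]; exists p => y z Ay Az; apply: pB; exact: AB.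
- move=> x Qx; have [U Ux [p pU]] := theta_exact (H x).
  have /nbhs_distP[e e0 eU] := Ux.
  have [r r0 rP] := (within_distP _ _).1 Hc x Qx e e0.
  exists (ball x r); first exact: nbhsx_ballx.
  by exists p => y z xy xz Qy Qz; apply: pU; apply: eU; exact: rP.
have [N _ NP] := near_infty_natSinv_lt (PosNum d0).
exists N => n Nn; have {NP} := NP n Nn; rewrite /= => nd.
have n0 : 0 < n.+1%:R :> R by rewrite ltr0n.
pose pt i : R := i%:R / n.+1%:R.
have pt0 : pt 0%N = 0 by rewrite /pt mul0r.
have pt1 : pt n.+1 = 1 by rewrite /pt divff// gt_eqF.
have pt01 i : (i <= n.+1)%N -> pt i \in `[0, 1].
  by move=> ni; rewrite in_itv/= /pt divr_ge0 ?ler0n//= ler_pdivrMr// mul1r ler_nat.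
have ptS i : `|pt i - pt i.+1| < d.
  by rewrite /pt distrC -mulrBl -natrB// subSnn mul1r ger0_norm.
pose th i j i' j' := theta (H (pt i, pt j)) (H (pt i', pt j')).
pose S j := \sum_(0 <= i < n.+1) th j i j i.+1.
have cell j i : (j < n.+1)%N -> (i < n.+1)%N ->
    th j i j i.+1 - th j.+1 i j.+1 i.+1 = th j i j.+1 i - th j i.+1 j.+1 i.+1.
  move=> jn i_n.
  have Qp a b : (a <= n.+1)%N -> (b <= n.+1)%N -> Q (pt a, pt b).
    by move=> an bn; split; exact: pt01.
  have [p pP] := dP (pt j, pt i) (Qp j i (ltnW jn) (ltnW i_n)).
  have bb a b : a = j \/ a = j.+1 -> b = i \/ b = i.+1 ->
      ball (pt j, pt i) d (pt a, pt b).
    by move=> [->|->] [->|->]; split; rewrite /ball/= ?subrr ?normr0.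
  rewrite /th !pP; try (by apply: bb; tauto); try (by apply: Qp => //; exact: ltnW).
  by ring.
have Seq j : (j < n.+1)%N -> S j = S j.+1.
  move=> jn; apply/eqP; rewrite -subr_eq0 /S -sumrB.
  rewrite (eq_big_nat _ _ (F2 := fun i => - (th j i.+1 j.+1 i.+1 - th j i j.+1 i))).
    rewrite sumrN telescope_sumr// /th pt0 pt1.
    have [-> ->] := Hs _ (pt01 _ (ltnW jn)); have [-> ->] := Hs _ (pt01 _ jn).
    by rewrite !thetaxx subrr oppr0.
  by move=> i /andP[_ i_n]; rewrite cell// opprB.
have S0 j : (j <= n.+1)%N -> S j = S 0%N.
  by elim: j => // j IHj jn; rewrite -Seq// IHj// ltnW.
transitivity (S 0%N).
  rewrite /S; apply: eq_big_nat => i /andP[_ i_n].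
  by rewrite /th pt0 !H0//; apply: pt01 => //; exact: ltnW.
rewrite -(S0 n.+1)// /S big_nat big1// => i /andP[_ i_n].
rewrite /th pt1 !H1 ?thetaxx//; apply: pt01 => //; exact: ltnW.
Qed.

Lemma simply_connected_sum_eq0 (g : R -> T) : simply_connected T ->
  continuous g -> g 0 = g 1 ->
  exists N, forall n, (N <= n)%N ->
    \sum_(0 <= i < n.+1) theta (g (i%:R / n.+1%:R)) (g (i.+1%:R / n.+1%:R)) = 0.
Proof.
move=> [_ sc] gc g01; have [H [Hc H0 H1 Hs]] := sc g (continuous_subspaceT gc) g01.
exact: homotopy_sum_eq0 Hc H0 H1 Hs.
Qed.

End Homotopy.

(** * Winding around one edge *)

Section Bridge.
Context {R : realType} {T : pmetricType R} {V : set T}.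
Hypothesis T_graph : metric_graph T.
Hypothesis V_vertex : vertex_set V.
Hypothesis T_simply_connected : simply_connected T.
Variable f : oriented_edge V.
Local Notation l := (elen f).

(* Position along f, normalised to [0, 1[; xget makes it 0 outside f. *)
Let height (x : T) : R := xget 0 [set t | (t \in `]0, l[) /\ epar f t = x] / l.

Let height_in t : t \in `]0, l[ -> height (epar f t) = t / l.
Proof.
move=> tl; rewrite /height; congr (_ / _).
have [sl st] : [set s | (s \in `]0, l[) /\ epar f s = epar f t]
    (xget 0 [set s | (s \in `]0, l[) /\ epar f s = epar f t]).
  by apply: (@xgetPex _ 0 [set s | (s \in `]0, l[) /\ epar f s = epar f t]); exists t.
exact: epar_inj sl tl st.
Qed.

Let height_out x : ~ edge_set f x -> height x = 0.
Proof.
move=> nx; rewrite /height xgetPN ?mul0r// => t [tl tx].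
by apply: nx; exists t.
Qed.

(* The increment of the height modulo 1, taken in [-1/2, 1/2]. *)
Let winding (y z : T) : R :=
  let d := height z - height y in
  if `|d| < 2^-1 then d else if 0 < d then d - 1 else d + 1.

(** Inside [f] the height itself is a potential. At other points the neighbourhood is the complement
    of the compact middle half of [f], where heights are within 1/4 of an integer. *)
Let winding_exact (x : T) : exists2 U : set T, nbhs x U &
  exists p : T -> R, forall y z, U y -> U z -> winding y z = p z - p y.
Proof.
have l0 := elen_gt0 f; have [[t tl <-]|nx] := pselect (edge_set f x).
  have [d [d0 dl _ dN]] := unit_param_local T_graph V_vertex
    (fun x => @edge_notin _ _ _ _ x (epar_edge f)) (epar_unit f) tl.
  pose e := Num.min d (l / 4).
  have e0 : 0 < e by rewrite lt_min d0 divr_gt0.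
  have ed : e <= d by rewrite ge_min lexx.
  have el : e <= l / 4 by rewrite ge_min lexx orbT.
  exists (epar f @` [set s | `|s - t| < e]); first exact: dN.
  exists height => _ _ [s /= st <-] [s' /= s't <-].
  rewrite /winding !height_in; try (apply: dl; exact: lt_le_trans ed).
  rewrite -mulrBl ifT// normrM normfV (gtr0_norm l0) ltr_pdivrMr//.
  apply: le_lt_trans (ler_distD t _ _) _; rewrite (distrC t).
  by move: st s't el; move: `|_| `|_| => a b; lra.
exists (~` (epar f @` `[l / 4, l / 4 * 3])).
  apply: open_nbhs_nbhs; split.
    apply: closed_openC; apply: compact_closed; first exact: metric_hausdorff.
    apply: continuous_compact; last exact: segment_compact.
    by apply: continuous_subspaceT; exact: epar_continuous.
  move=> [t tl tx]; apply: nx; exists t => //.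
  by move: tl; rewrite /= !in_itv/= => /andP[? ?]; apply/andP; split; lra.
exists (fun y => if height y < 2^-1 then height y else height y - 1).
have hU y : (~` (epar f @` `[l / 4, l / 4 * 3])) y ->
    0 <= height y < 4^-1 \/ 3 / 4 < height y < 1.
  move=> Uy; have [[t tl ty]|ny] := pselect (edge_set f y); last first.
    by left; rewrite height_out// lexx invr_gt0 ltr0n.
  rewrite -ty height_in//; move: (tl); rewrite /= in_itv/= => /andP[t0 tl'].
  have [t4|t4] := ltP t (l / 4).
    left; rewrite divr_ge0 ?ltW//= ltr_pdivrMr//; lra.
  right; apply/andP; split; last by rewrite ltr_pdivrMr// mul1r.
  rewrite ltr_pdivlMr// ltNge; apply/negP => t4'; apply: Uy; exists t => //.
  rewrite /= in_itv/= t4/=; lra.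
by move=> y z /hU hy /hU hz; exact: reduced_difference.
Qed.

Lemma no_return_path (F : R -> T) (L : R) : 0 <= L ->
  (forall s t, mdist (F s) (F t) <= `|s - t|) -> F 0 = eplus f -> F L = eminus f ->
  (forall t, 0 <= t <= L -> ~ edge_set f (F t)) -> False.
Proof.
move=> L0 Fl F0 FL Favoid; have l0 := elen_gt0 f.
pose H t := if t <= l then epar f t else F (t - l).
have Hl : forall s t, mdist (H s) (H t) <= `|s - t|.
  apply: (@glue_lipschitz _ _ (epar f) (fun t => F (t - l))).
  - exact: epar_lipschitz.
  - by move=> s t; apply: le_trans (Fl _ _) _; rewrite opprB addrA subrK.
  - by rewrite subrr F0.
pose M := l + L.
have M0 : 0 < M by rewrite ltr_pwDl.
have hH t : 0 <= t -> t <= M -> height (H t) = if t / l < 1 then t / l else 0.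
  move=> t0 tM; rewrite ltr_pdivrMr// mul1r /H; case: (ltgtP t l) => [tl|tl|->].
  - have [->|tn0] := eqVneq t 0.
      rewrite mul0r height_out// => fe.
      exact: (edge_notin (epar_edge f) fe (eminus_vertex T_graph V_vertex f)).
    by rewrite height_in// in_itv/= tl andbT lt_neqAle eq_sym tn0.
  - rewrite height_out//; apply: Favoid; rewrite subr_ge0 ltW//=.
    by move: tM; rewrite /M; lra.
  - rewrite height_out// => fe.
    exact: (edge_notin (epar_edge f) fe (eplus_vertex T_graph V_vertex f)).
(* The height unwrapped along the loop: it climbs from 0 to 1 over [f] and stays at 1 during the
   return, so its increments add up to 1. *)
pose w t := Num.min (t / l) 1.
have windingH s t : 0 <= s -> s <= t -> t <= M -> t - s < l / 2 ->
    winding (H s) (H t) = w t - w s.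
  move=> s0 st tM ts; rewrite /winding !hH ?(le_trans st) ?(le_trans s0)//.
  apply: wrapped_increment; first by rewrite divr_ge0// ltW.
    by rewrite ler_pM2r ?invr_gt0.
  by rewrite -mulrBl ltr_pdivrMr// mulrC.
pose g t := H (t * M).
have gc : continuous g.
  apply/continuous_distP => x e e0; exists (e / M); first by rewrite divr_gt0.
  move=> y; rewrite /ball/= ltr_pdivlMr// => xy; apply: le_lt_trans (Hl _ _) _.
  by rewrite -mulrBl normrM (gtr0_norm M0).
have g01 : g 0 = g 1.
  rewrite /g mul0r mul1r /H (ltW l0) -/(eminus f) -FL.
  have [Ml|lM] := leP M l; last by rewrite /M addrAC subrr add0r.
  have L00 : L = 0 by move: Ml; rewrite /M; lra.
  by rewrite /M L00 addr0 F0.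
have [N NP] := simply_connected_sum_eq0 winding_exact T_simply_connected gc g01.
have c0 : 0 < l / 2 / M by rewrite !divr_gt0.
have [N' _ N'P] := near_infty_natSinv_lt (PosNum c0).
(* Large enough both for the sum to vanish and for each step to be shorter than [l / 2], as
   [windingH] requires. *)
pose n := maxn N N'; have := NP n (leq_maxl _ _).
have n0 : 0 < n.+1%:R :> R by rewrite ltr0n.
have {N'P} := N'P n (leq_maxr _ _); rewrite /= ltr_pdivlMr// => nM.
rewrite (eq_big_nat _ _ (F2 := fun i => w (i.+1%:R / n.+1%:R * M) - w (i%:R / n.+1%:R * M))).
  rewrite (telescope_sumr (fun i => w (i%:R / n.+1%:R * M)))// divff ?gt_eqF//.
  rewrite mul1r !mul0r /w mul0r min_r; last by rewrite ler_pdivlMr// mul1r lerDl.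
  rewrite min_l ?ler01// subr0 => /eqP.
  by rewrite oner_eq0.
move=> i /andP[_ i_n]; apply: windingH.
- by rewrite !mulr_ge0 ?invr_ge0 ?ler0n// ltW.
- by rewrite ler_pM2r// ler_pM2r ?invr_gt0// ler_nat.
- by rewrite ger_pMl// ler_pdivrMr// mul1r ler_nat.
- by rewrite -mulrBl -mulrBl -natrB// subSnn mul1r.
Qed.

(** The edges of the walk are concatenated. An edge meeting [edge_set f] equals it, so by
    [edge_set_eq] it could only be [f] or [ebar f], and its ends are vertices. *)
Lemma avoiding_walk_path u v : V u ->
  avoiding_walk (@ebar R T V) (@eminus R T V) f u v ->
  exists F : R -> T, exists2 L : R, 0 <= L & [/\ F 0 = u, F L = v,
    forall s t, mdist (F s) (F t) <= `|s - t|
    & forall t, 0 <= t <= L -> ~ edge_set f (F t)].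
Proof.
move=> Vu; elim=> [|b _ [F [L L0 [F0 FL Fl Fa]]] bf bf'].
  exists (fun=> u), 0 => //; split=> // [s t|t _ fu]; first by rewrite mdistxx.
  exact: (edge_notin (epar_edge f) fu Vu).
have lb := elen_gt0 b.
exists (fun t => if t <= L then F t else epar b (t - L)), (L + elen b).
  by rewrite addr_ge0// ltW.
split.
- by rewrite L0.
- by rewrite eminus_ebar leNgt ltrDl lb/= addrAC subrr add0r.
- apply: glue_lipschitz => //; last by rewrite subrr FL.
  by move=> s t; apply: le_trans (epar_lipschitz _ _ _) _; rewrite opprB addrA subrK.
move=> t /andP[t0 tL]; have [tL'|Lt] := leP t L; first by apply: Fa; rewrite t0.
have sub : edge_set b (epar b (t - L)) \/ V (epar b (t - L)).
  have [->|tb] := eqVneq (t - L) (elen b); first by right; exact: eplus_vertex.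
  left; apply: epar_edge_set; rewrite in_itv/= subr_gt0 Lt/= lt_neqAle tb.
  by rewrite lerBlDl.
move=> ft; case: sub => [bt|Vt]; last exact: (edge_notin (epar_edge f) ft Vt).
have : edge_set f = edge_set b by exact: (edges_eq (epar_edge f) (epar_edge b) ft bt).
by move=> /edge_set_eq[].
Qed.

Lemma simply_connected_bridge :
  ~ avoiding_walk (@ebar R T V) (@eminus R T V) f (eplus f) (eminus f).
Proof.
move=> /(avoiding_walk_path (eplus_vertex T_graph V_vertex f)).
by move=> [F [L L0 [F0 FL Fl Fa]]]; exact: no_return_path L0 Fl F0 FL Fa.
Qed.

End Bridge.

Theorem theoremD (R : realType) (Gamma Gamma' : pmetricType R)
    (V : set Gamma) (k : nat) (phi : Gamma' -> Gamma)
    (mu : {measure set (borel Gamma') -> \bar R})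
    (mu_phi : {measure set (borel Gamma) -> \bar R})
    (Gamma_graph : metric_graph Gamma)
    (Gamma_compact : compact [set: Gamma])
    (V_model : vertex_set V)
    (k_ge3 : (3 <= k)%N)
    (V_regular : regular_model V k)
    (V_lengths : equal_lengths V)
    (Gamma'_graph : metric_graph Gamma')
    (phi_universal : universal_covering phi)
    (phi_isometric : isometric_on_sheets phi)
    (mu_canonical : canonical_measure mu)
    (mu_phi_pushdown : pushdown V phi mu mu_phi) :
  forall e : set Gamma, edges V e -> mu_phi e = (1 - 2 / k%:R)%:E.

Proof.
have [[phi_continuous phi_surj _] T'_sc] := phi_universal.
pose V' := phi @^-1` V.
have V'_model : vertex_set V' by exact: lifted_vertex_set.
move=> C VC; have [x nVx _] := VC.
have [e eC] := edge_parametrized Gamma_compact V_model VC.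
have [t tl _] : exists2 t, t \in `]0, elen e[ & True.
  exists (elen e / 2) => //; have := elen_gt0 e.
  by rewrite in_itv/= => l0; apply/andP; split; lra.
have [x' _ x't] : [set phi z | z in [set: Gamma']] (epar e t) by exact: phi_surj.
have tl' : t \in `[0, elen e].
  by move: tl; rewrite !in_itv/= => /andP[/ltW -> /ltW ->].
have [f0 [f0l phif0 _]] := lift_oriented_edge Gamma_graph Gamma_compact V_model
  phi_isometric phi_continuous tl' x't.
have [Or Or_orient] := orientation_exists f0.
(* [canonical_measure] evaluates only edges selected by the orientation, so [f0] is reversed if
   necessary; its edge set stays the same. *)
have [f [Of fl phif]] : exists f : oriented_edge V',
    [/\ Or f, elen f = elen e & phi @` edge_set f = C].
  have phiC : phi @` edge_set f0 = C.
    rewrite -eC; apply/seteqP; split=> [_ [_ [s sl <-] <-]|_ [s sl <-]].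
      by exists s; [rewrite /= -f0l|rewrite phif0].
    by exists (epar f0 s); [exists s => //=; rewrite f0l|rewrite phif0].
  have [Of|nOf] := pselect (Or f0); first by exists f0.
  by exists (ebar f0); rewrite edge_set_ebar; split=> //; exact/Or_orient.
have [_ _ mu_lift] := mu_phi_pushdown.
rewrite (mu_lift _ _ VC (epar_edge f) phif).
have [_ /(_ f Of)[_ mu_f]] := mu_canonical V' Or V'_model Or_orient.
rewrite -/(edge_set f) mu_f; congr EFin.
have V'_regular : regular_model V' k.
  by move=> v Vv; apply: lifted_valence => //; exact: V_regular.
have eminusV' (b : oriented_edge V') : V' (eminus b) by exact: eminus_vertex.
have [out [mem_out out_uniq out_size]] := finite_out V'_regular eminusV'.
have k0 : (0 < k)%N by apply: leq_trans k_ge3.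
have k1 : k = k.-1.+1 by rewrite prednK.
rewrite (@coef_harmonic_proj _ _ _ Or f out k.-1 (elen e))//.
- have k0' : k%:R != 0 :> R by rewrite pnatr_eq0 -lt0n.
  rewrite natr1 -k1 -[in LHS](addrK 1 (k.-1)%:R) natr1 -k1; field.
  exact: k0'.
- by move=> b; exact: simply_connected_bridge.
- by case: (k) k_ge3 => [|[|[]]].
- by move=> b; rewrite out_size.
- by move=> b; apply: lifted_elen.
Qed.
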